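(* Let $\Omega=\{(x^1,x^2)\in\mathbb{R}^2 : x^2<0\}$, $\Omega^\ast=\{(u_1,u_2)\in\mathbb{R}^2 : u_2>u_1^2\}$, and $$\Phi(x)=-\frac{(x^1)^2}{4x^2}-\frac12\log\Big(-\frac{x^2}{\pi}\Big)\quad (x\in\Omega),$$ and let $\Phi^\ast:\Omega^\ast\to\mathbb{R}$ be the Legendre dual of $\Phi$. Let $\mathbb{M}=(T\Omega,G_\Phi)$ and $\mathbb{W}=(T\Omega^\ast,G_{\Phi^\ast})$ be the associated Kähler tube domains. Then: (1) $\mathbb{M}$ and $\mathbb{W}$ are both Kähler–Ricci solitons. (2) They are immortally coupled under Kähler–Ricci flow: there exist, for all $t\in[0,\infty)$, complete solutions $G_{\Phi_t}$ on $T\Omega$ and $G_{\Psi_t}$ on $T\Omega^\ast$ of the Kähler–Ricci flow $\partial_t G=-2\,\mathrm{Ric}(G)$, with initial metrics $G_{\Phi_0}=G_{\Phi}$ and $G_{\Psi_0}=G_{\Phi^\ast}$, such that for every $t\ge 0$ the Kähler manifolds $(T\Omega,G_{\Phi_t})$ and $(T\Omega^\ast,G_{\Psi_t})$ form a statistical mirror pair, i.e. the potentials can be chosen so that $\Psi_t$ is the Legendre dual of $\Phi_t$ and its domain is $\Omega^\ast$.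
   Context: For a domain $U\subset\mathbb{R}^n$, the tube domain is $TU=\{x+\sqrt{-1}\,y\in\mathbb{C}^n : x\in U,\ y\in\mathbb{R}^n\}$. For a smooth function $\Phi:U\to\mathbb{R}$ with positive definite Hessian, $G_\Phi$ denotes the Riemannian metric on $TU$ $$G_\Phi=\sum_{i,j}\frac{\partial^2\Phi}{\partial x^i\partial x^j}(x)\,(dx^i dx^j+dy^i dy^j),$$ which is Kähler for the standard complex structure, with Kähler form $\frac{\sqrt{-1}}{2}\sum_{i,j}\frac{\partial^2\Phi}{\partial x^i\partial x^j}\,dz^i\wedge d\bar z^j$. For metrics of this form the Kähler–Ricci flow $\partial_tG=-2\mathrm{Ric}(G)$ is induced by the evolution $\partial_t\Phi=\log\det D^2\Phi$ of potentials. Legendre dual: $\Phi^\ast(u)=\sup_{x\in U}\big(\langle x,u\rangle-\Phi(x)\big)$, considered on the image of the gradient map $x\mapsto D\Phi(x)$; here the image of $\Omega$ is $\Omega^\ast$. Statistical mirror pair: two Kähler tube domains $(TU,G_\Phi)$ and $(TU^\ast,G_{\Phi^\ast})$ where $U^\ast=D\Phi(U)$ and $\Phi^\ast$ is the Legendre dual of $\Phi$. Kähler–Ricci soliton: a Kähler manifold with metric $G$ for which there are a constant $\lambda\in\mathbb{R}$ and a real vector field $V$ preserving the complex structure (i.e. the real part of a holomorphic vector field) such that $\mathrm{Ric}(G)=\lambda G+\mathcal{L}_VG$. (Here $\Phi$ is the log-partition function of the family of univariate normal distributions in natural parameters $x^1=\mu/\sigma^2$, $x^2=-1/(2\sigma^2)$,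 and $u_1=\mu$, $u_2=\mu^2+\sigma^2$ are the expectation parameters.) *)

(* Defs.v *)
From HB Require Import structures.
From mathcomp Require Import all_boot all_order all_algebra.
From mathcomp Require Import all_classical all_reals all_analysis.

Set Implicit Arguments.
Unset Strict Implicit.
Unset Printing Implicit Defensive.

Import Order.TTheory GRing.Theory Num.Theory.
Import numFieldNormedType.Exports.

Local Open Scope classical_set_scope.
Local Open Scope ring_scope.

(** Points and tangent vectors of R^m are row vectors.  A bilinear form with
    matrix [A] is [(u, v) |-> u *m A *m v^T], and an endomorphism with matrix
    [A] acts by [v |-> v *m A]. *)

Section Smoothness.
Variables (R : realType) (m : nat).
Implicit Types (U A : set 'rV[R]_m) (f : 'rV[R]_m -> R).

(** Meant for open [U]: all iterated partial derivatives of order at most [k]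
    exist and are continuous at every point of [U]. *)
Fixpoint Ck (k : nat) U f : Prop :=
  (forall x, U x -> {for x, continuous f}) /\
  (if k is k'.+1 then
     forall i : 'I_m, (forall x, U x -> derivable f x 'e_i) /\ Ck k' U ('D_'e_i f)
   else True).

Definition smooth U f : Prop := forall k, Ck k U f.

(** Smoothness on a set that need not be open: local smooth extendability. *)
Definition smooth_on A f : Prop :=
  forall x, A x -> exists U h,
    [/\ open U, U x, smooth U h & forall y, U y -> A y -> f y = h y].

Definition smooth_vfield U (V : 'rV[R]_m -> 'rV[R]_m) : Prop :=
  forall i, smooth U (fun x => V x 0 i).

Definition smooth_tensor U (g : 'rV[R]_m -> 'M[R]_m) : Prop :=
  forall i j, smooth U (fun x => g x i j).

Definition posdef (A : 'M[R]_m) : Prop :=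
  A^T = A /\ forall v : 'rV[R]_m, v != 0 -> 0 < (v *m A *m v^T) 0 0.

End Smoothness.

Section Riemannian.
Variables (R : realType) (m : nat).
Implicit Types (M : set 'rV[R]_m) (g : 'rV[R]_m -> 'M[R]_m) (p q : 'rV[R]_m).

(** The Christoffel symbol [Gamma^k_(i j)]. *)
Definition christoffel g (k i j : 'I_m) p : R :=
  2^-1 * \sum_l invmx (g p) k l *
    ('D_'e_i (fun x => g x j l) p + 'D_'e_j (fun x => g x i l) p
     - 'D_'e_l (fun x => g x i j) p).

Definition ricci g p : 'M[R]_m := \matrix_(i, j) \sum_k
  ('D_'e_k (christoffel g k i j) p - 'D_'e_j (christoffel g k i k) p
   + \sum_l (christoffel g k k l p * christoffel g l i j p
             - christoffel g k j l p * christoffel g l i k p)).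

(** Lie derivatives along [V] of a field of bilinear forms and of a field of
    endomorphisms.  With the row convention ['J V p a c] is [d V^c / d x^a]. *)
Definition lie_form (V : 'rV[R]_m -> 'rV[R]_m) g p : 'M[R]_m :=
  \matrix_(a, b) 'D_(V p) (fun x => g x a b) p
  + 'J V p *m g p + g p *m ('J V p)^T.

Definition lie_endo (V : 'rV[R]_m -> 'rV[R]_m) (A : 'rV[R]_m -> 'M[R]_m) p
    : 'M[R]_m :=
  \matrix_(a, b) 'D_(V p) (fun x => A x a b) p
  + 'J V p *m A p - A p *m 'J V p.

(** A C^1 arc on [0, 1] always extends to a C^1 map on the whole line, so it is
    represented by such an extension; only its values on [0, 1] matter. *)
Definition C1_arc M (c : R -> 'rV[R]_m) : Prop :=
  [/\ forall t, derivable c t 1, continuous (derive1 c)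
    & forall t, 0 <= t <= 1 -> M (c t)].

Definition arc_length g (c : R -> 'rV[R]_m) : R :=
  \int[lebesgue_measure]_(t in `[0, 1])
    Num.sqrt ((derive1 c t *m g (c t) *m (derive1 c t)^T) 0 0).

(** A piecewise C^1 curve from [p] to [q], as the list of its C^1 pieces. *)
Fixpoint pw_curve M p (cs : seq (R -> 'rV[R]_m)) q : Prop :=
  if cs is c :: cs' then [/\ C1_arc M c, c 0 = p & pw_curve M (c 1) cs' q]
  else p = q.

Definition riem_dist M g p q : \bar R :=
  ereal_inf [set (\sum_(c <- cs) arc_length g c)%:E | cs in
             [set cs | pw_curve M p cs q]].

(** Completeness of [M] as a metric space for the Riemannian distance. *)
Definition complete_metric M g : Prop :=
  forall u : nat -> 'rV[R]_m, (forall k, M (u k)) ->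
    (forall e, 0 < e -> exists N, forall k l, (N <= k)%N -> (N <= l)%N ->
       (riem_dist M g (u k) (u l) < e%:E)%E) ->
    exists2 p, M p & forall e, 0 < e -> exists N, forall k, (N <= k)%N ->
       (riem_dist M g (u k) p < e%:E)%E.

End Riemannian.

Section Kahler.
Variables (R : realType) (n : nat).
Implicit Types (M : set 'rV[R]_(n + n)) (g : 'rV[R]_(n + n) -> 'M[R]_(n + n)).

(** The point [x + sqrt(-1) y] of C^n is [row_mx x y], and the complex structure
    sends [(a, b)] to [(- b, a)]. *)
Definition complex_str : 'M[R]_(n + n) := block_mx 0 1%:M (- 1%:M) 0.

(** [omega(u, v) = g(J u, v)]. *)
Definition kahler_form g (p : 'rV[R]_(n + n)) : 'M[R]_(n + n) :=
  complex_str *m g p.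

Definition closed_form (w : 'rV[R]_(n + n) -> 'M[R]_(n + n))
    (p : 'rV[R]_(n + n)) : Prop :=
  forall a b c, 'D_'e_a (fun x => w x b c) p + 'D_'e_b (fun x => w x c a) p
                + 'D_'e_c (fun x => w x a b) p = 0.

Definition kahler_manifold M g : Prop :=
  [/\ open M, smooth_tensor M g, forall p, M p -> posdef (g p),
      forall p, M p -> complex_str *m g p *m complex_str^T = g p
    & forall p, M p -> closed_form (kahler_form g) p].

Definition kr_soliton M g : Prop :=
  kahler_manifold M g /\
  exists (lambda : R) (V : 'rV[R]_(n + n) -> 'rV[R]_(n + n)),
    [/\ smooth_vfield M V,
        forall p, M p -> lie_endo V (fun=> complex_str) p = 0
      & forall p, M p -> ricci g p = lambda *: g p + lie_form V g p].

(** Solutions on the time interval [[0, +oo[], smooth jointly in time and space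
    up to [t = 0]; the time derivative is one-sided at [t = 0]. *)
Definition krf_solution M (g : R -> 'rV[R]_(n + n) -> 'M[R]_(n + n)) : Prop :=
  [/\ forall t, 0 <= t -> kahler_manifold M (g t),
      forall i j, smooth_on
        [set q : 'rV[R]_(1 + (n + n)) | 0 <= lsubmx q 0 0 /\ M (rsubmx q)]
        (fun q => g (lsubmx q 0 0) (rsubmx q) i j)
    & forall t p, 0 <= t -> M p ->
        (s - t)^-1 *: (g s p - g t p) @[s --> within `[0, +oo[ t^']
          --> (-2) *: ricci (g t) p].

End Kahler.

Section Tube.
Variables (R : realType) (n : nat).
Implicit Types (U : set 'rV[R]_n) (F : 'rV[R]_n -> R).

Definition grad F (x : 'rV[R]_n) : 'rV[R]_n := \row_i 'D_'e_i F x.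

Definition hess F (x : 'rV[R]_n) : 'M[R]_n :=
  \matrix_(i, j) 'D_'e_i ('D_'e_j F) x.

Definition tube U : set 'rV[R]_(n + n) := [set p | U (lsubmx p)].

Definition tube_metric F (p : 'rV[R]_(n + n)) : 'M[R]_(n + n) :=
  block_mx (hess F (lsubmx p)) 0 0 (hess F (lsubmx p)).

Definition kahler_potential U F : Prop :=
  [/\ open U, connected U, U !=set0, smooth U F
    & forall x, U x -> posdef (hess F x)].

Definition legendre_set U F (u : 'rV[R]_n) : set R :=
  [set (x *m u^T) 0 0 - F x | x in U].

Definition legendre U F (u : 'rV[R]_n) : R := sup (legendre_set U F u).

(** [has_sup] rules out the default value of [sup] on the image of the gradient
    map, where the Legendre dual is considered. *)
Definition mirror_pair U F U' F' : Prop :=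
  [/\ kahler_potential U F, kahler_potential U' F', grad F @` U = U'
    & forall u, U' u -> has_sup (legendre_set U F u) /\ F' u = legendre U F u].

End Tube.

Section NormalFamily.
Variable R : realType.

Definition Omega : set 'rV[R]_2 := [set x | x 0 1 < 0].

Definition Omega_star : set 'rV[R]_2 := [set u | u 0 0 ^+ 2 < u 0 1].

Definition log_partition (x : 'rV[R]_2) : R :=
  - (x 0 0 ^+ 2 / (4 * x 0 1)) - 2^-1 * ln (- (x 0 1 / pi)).

End NormalFamily.

Arguments Omega R : clear implicits.
Arguments Omega_star R : clear implicits.
Arguments log_partition R : clear implicits.

(* Main.v *)
Require Import Defs.
From mathcomp Require Import all_boot all_order all_algebra.
From mathcomp Require Import all_classical all_reals all_analysis.
From mathcomp Require Import ring lra zify.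
Import Order.TTheory GRing.Theory Num.Theory.
Import numFieldNormedType.Exports.
Set Implicit Arguments.
Unset Strict Implicit.
Unset Printing Implicit Defensive.
Local Open Scope classical_set_scope.
Local Open Scope ring_scope.

(** Write [b] for the second coordinate of a point [x] of [Omega] and [s] for
    [u_2 - u_1^2] on [Omega_star].  Up to additive constants, the given
    potential is [A + c B] with [A = - x_1^2 / (4 b)], [B = - ln (- b)] and
    [c = 1 / 2], and a direct computation gives the Legendre dual of [A + c B]:
    it is [c B'] with [B' = - ln s].

    The Ricci tensor of a tube metric is [- (1/2) Hess (ln det Hess F)], on the
    real and on the imaginary directions ([ricci_tube]).  Now
    [det Hess (A + c B) = c / (2 (- b)^3)] and [det Hess (c B') = 2 c^2 / s^3],
    so that, up to constants, [ln det Hess] is [3 B] in the first case and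
    [3 B'] in the second, for every [c > 0].  Hence the Ricci tensors do not
    depend on [c] and are [- (3/2)] times the tube tensors of [B] and of [B']
    ([christoffel_trace_normal], [christoffel_trace_dual]).

    The flow moves [c] at constant speed: [c = 1 / 2 + 3 t] solves the
    Kahler-Ricci flow on both sides ([krf_pencil]), and at each time the two
    potentials are Legendre dual to each other ([mirror_normal]).

    At [c = 1 / 2] the dual metric is Einstein with constant [- 3].  On the
    other side the [A] part has to be corrected: the holomorphic field
    [(3/2) z_1 d/dz_1] preserves [B] and multiplies [A] by [3], so that
    [- (3/2) B = - 3 (A + B / 2) + 3 A] is the soliton equation
    ([soliton_normal], [soliton_dual]).

    For completeness, it is enough to find a proper function whose logarithm
    is Lipschitz for the metric (Gordon's criterion, [complete_of_proper]).
    The sum of [h^4], [h^-4], [q^4], [y_1^2] and [y_2^2] does it in both cases,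
    where [h] is the argument of the logarithm of the potential ([- b] or [s])
    and [q] is [x_1 / b] or [u_1].  In the variables [ln h] and [q], the
    metrics become diagonal on the base, and the gradient estimate reduces to
    elementary inequalities ([gradient_bound_normal], [gradient_bound_dual]). *)

(** * Elementary functions *)

Section Elementary.
Variable R : realType.

(** Syntax for the functions built from the coordinates by rational operations
    and logarithms.  As the class is closed under derivation, smoothness, the
    symmetry of partial derivatives and the explicit derivatives are all read
    off from a formal derivation. *)
Inductive elem (m : nat) : Type :=
| Cst of R
| Coord of 'I_m
| Add of elem m & elem m
| Mul of elem m & elem m
| Inv of elem m
| Ln of elem m.

Arguments Cst {m}.

Fixpoint eval m (e : elem m) (x : 'rV[R]_m) : R :=
  match e with
  | Cst a => a
  | Coord i => x 0 i
  | Add e1 e2 => eval e1 x + eval e2 x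
  | Mul e1 e2 => eval e1 x * eval e2 x
  | Inv e1 => (eval e1 x)^-1
  | Ln e1 => ln (eval e1 x)
  end.

(** Where the rules of calculus apply to [e]: [eval] is total, but inverse and
    logarithm take arbitrary values outside of their domains. *)
Fixpoint dom m (e : elem m) (x : 'rV[R]_m) : Prop :=
  match e with
  | Cst _ | Coord _ => True
  | Add e1 e2 | Mul e1 e2 => dom e1 x /\ dom e2 x
  | Inv e1 => dom e1 x /\ eval e1 x != 0
  | Ln e1 => dom e1 x /\ 0 < eval e1 x
  end.

Fixpoint deriv m (v : 'rV[R]_m) (e : elem m) : elem m :=
  match e with
  | Cst _ => Cst 0
  | Coord i => Cst (v 0 i)
  | Add e1 e2 => Add (deriv v e1) (deriv v e2)
  | Mul e1 e2 => Add (Mul e1 (deriv v e2)) (Mul e2 (deriv v e1))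
  | Inv e1 => Mul (Cst (-1)) (Mul (deriv v e1) (Mul (Inv e1) (Inv e1)))
  | Ln e1 => Mul (deriv v e1) (Inv e1)
  end.

(** Pullback to a product: [s] places the coordinates of the base of a tube
    among those of the tube, or those of the tube among those of space-time. *)
Fixpoint rename m k (s : 'I_m -> 'I_k) (e : elem m) : elem k :=
  match e with
  | Cst a => Cst a
  | Coord i => Coord (s i)
  | Add e1 e2 => Add (rename s e1) (rename s e2)
  | Mul e1 e2 => Mul (rename s e1) (rename s e2)
  | Inv e1 => Inv (rename s e1)
  | Ln e1 => Ln (rename s e1)
  end.

Lemma eval_rename m k (s : 'I_m -> 'I_k) (e : elem m) (x : 'rV[R]_k) :
  eval (rename s e) x = eval e (\row_i x 0 (s i)).
Proof.
by elim: e => //= [i|e1 -> e2 ->|e1 -> e2 ->|e1 ->|e1 ->] //; rewrite mxE.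
Qed.

Lemma dom_rename m k (s : 'I_m -> 'I_k) (e : elem m) (x : 'rV[R]_k) :
  dom (rename s e) x = dom e (\row_i x 0 (s i)).
Proof.
by elim: e => //= [e1 -> e2 ->|e1 -> e2 ->|e1 ->|e1 ->] //;
  rewrite eval_rename.
Qed.

Variable m : nat.
Implicit Types (e : elem m) (x v w : 'rV[R]_m) (U : set 'rV[R]_m).

Lemma dom_deriv v e x : dom e x -> dom (deriv v e) x.
Proof.
by elim: e => //= [e1 IH1 e2 IH2|e1 IH1 e2 IH2|e1 IH1|e1 IH1] [d1 d2];
  split; auto; split; auto; rewrite gt_eqF.
Qed.

Lemma differentiable_eval e x : dom e x -> differentiable (eval e) x.
Proof.
elim: e => /= [a|i|e1 IH1 e2 IH2|e1 IH1 e2 IH2|e1 IH1|e1 IH1].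
- by move=> _; exact: differentiable_cst.
- by move=> _; exact: differentiable_coord.
- by move=> [/IH1 d1 /IH2 d2]; exact: differentiableD.
- by move=> [/IH1 d1 /IH2 d2]; exact: differentiableM.
- by move=> [/IH1 d1 n0]; exact: differentiableV.
- move=> [/IH1 d1 p0];
  apply: (@differentiable_comp _ _ R^o R^o (eval e1) (@ln R)) => //.
  by apply/derivable1_diffP; exact: (@ex_derive _ _ _ _ _ _ _ (is_derive1_ln p0)).
Qed.

Lemma continuous_eval e x : dom e x -> {for x, continuous (eval e)}.
Proof. by move=> /differentiable_eval/differentiable_continuous. Qed.

Lemma derivable_eval e x v : dom e x -> derivable (eval e) x v.
Proof. by move=> /differentiable_eval/diff_derivable; apply. Qed.

Lemma derive_eval e x v : dom e x -> 'D_v (eval e) x = eval (deriv v e) x.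
Proof.
elim: e => /= [a|i|e1 IH1 e2 IH2|e1 IH1 e2 IH2|e1 IH1|e1 IH1].
- by move=> _; rewrite (derive_cst a).
- move=> _; have d := @differentiable_coord R 1 m x 0 i.
  rewrite (deriveE _ d).
  have @f : {linear 'rV[R]_m -> R}.
    by exists (fun N : 'rV[R]_m => N 0 i); do 2![eexists]; do ?[constructor];
       rewrite ?mxE// => ? *; rewrite ?mxE//; move=> ?; rewrite !mxE.
  rewrite (_ : (fun _ => _) = f :> ('rV[R]_m -> R)) // diff_lin //.
  exact: coord_continuous.
- move=> [d1 d2]; rewrite -IH1 // -IH2 //.
  by apply: deriveD; exact: derivable_eval.
- move=> [d1 d2]; rewrite -IH1 // -IH2 //.
  by apply: deriveM; exact: derivable_eval.
- move=> [d1 n0]; rewrite -IH1 // deriveV //; last exact: derivable_eval.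
  by rewrite -exprVn expr2 /GRing.scale /=; ring.
- move=> [d1 p0].
  have dl : derivable (@ln R) (eval e1 x) 1.
    exact: (@ex_derive _ _ _ _ _ _ _ (is_derive1_ln p0)).
  have df : differentiable (@ln R \o eval e1) x.
    apply: differentiable_comp; first exact: differentiable_eval.
    exact/derivable1_diffP.
  rewrite (deriveE _ df) diff_comp //; first last.
  - exact/derivable1_diffP.
  - exact: differentiable_eval.
  rewrite /= deriv1E // -IH1 // deriveE; last exact: differentiable_eval.
  rewrite derive1E (@derive_val _ _ _ _ _ _ _ (is_derive1_ln p0)).
  by [].
Qed.

(** Schwarz's theorem: by induction, both sides are the same polynomial in the
    derivatives of the subexpressions. *)
Lemma deriv_deriv v w e x :
  eval (deriv v (deriv w e)) x = eval (deriv w (deriv v e)) x.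
Proof.
elim: e => //= [e1 -> e2 -> //|e1 -> e2 ->|e1 ->|e1 ->]; ring.
Qed.

Lemma deriv_sum v e x :
  eval (deriv v e) x = \sum_i v 0 i * eval (deriv 'e_i e) x.
Proof.
elim: e => /= [a|i|e1 -> e2 ->|e1 -> e2 ->|e1 ->|e1 ->].
- by rewrite big1 // => i _; rewrite mulr0.
- rewrite (bigD1 i) //= mxE !eqxx mulr1 big1 ?addr0 // => j ji.
  by rewrite mxE eqxx /= eq_sym (negbTE ji) mulr0.
- by rewrite -big_split; apply: eq_bigr => i _; rewrite mulrDr.
- rewrite !mulr_sumr -big_split; apply: eq_bigr => i _ /=; ring.
- rewrite mulrC !mulr_suml; apply: eq_bigr => i _ /=; ring.
- rewrite mulr_suml; apply: eq_bigr => i _ /=; ring.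
Qed.

(** The next lemmas express that regularity and derivatives on an open set
    depend only on the values there.  They allow trading a function such as a
    Legendre transform for an expression that is valid on the domain only. *)
Lemma near_open U (P : 'rV[R]_m -> Prop) x :
  open U -> U x -> (forall y, U y -> P y) -> \forall y \near x, P y.
Proof. by move=> oU Ux UP; apply: filterS (open_nbhs_nbhs (conj oU Ux)). Qed.

Lemma eq_open_derive U (f g : 'rV[R]_m -> R) v x : open U ->
  (forall y, U y -> f y = g y) -> U x -> 'D_v f x = 'D_v g x.
Proof.
by move=> oU fg Ux; apply: near_eq_derive; exact: near_open oU Ux fg.
Qed.

Lemma eq_open_derivable U (f g : 'rV[R]_m -> R) v x : open U ->
  (forall y, U y -> f y = g y) -> U x -> derivable f x v -> derivable g x v.
Proof.
by move=> oU fg Ux; apply: near_eq_derivable; exact: near_open oU Ux fg.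
Qed.

Lemma eq_open_continuous U (f g : 'rV[R]_m -> R) x : open U ->
  (forall y, U y -> f y = g y) -> U x ->
  {for x, continuous f} -> {for x, continuous g}.
Proof.
move=> oU fg Ux; rewrite /prop_for /continuous_at -(fg _ Ux) => cf.
apply: cvg_trans cf; apply: (near_eq_cvg (F := nbhs x)).
by apply: (near_open oU Ux) => y Uy; rewrite fg.
Qed.

Lemma eq_open_Ck U k (f g : 'rV[R]_m -> R) : open U ->
  (forall y, U y -> f y = g y) -> Ck k U f -> Ck k U g.
Proof.
move=> oU; elim: k f g => [|k IH] f g fg /= [cf df]; split => //.
- by move=> x Ux; exact: (eq_open_continuous oU fg Ux (cf x Ux)).
- by move=> x Ux; exact: (eq_open_continuous oU fg Ux (cf x Ux)).
move=> i; have [dfi Cf] := df i; split.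
  by move=> x Ux; exact: (eq_open_derivable oU fg Ux (dfi x Ux)).
by apply: IH Cf => y Uy; exact: (eq_open_derive _ oU fg Uy).
Qed.

Lemma eq_open_smooth U (f g : 'rV[R]_m -> R) : open U ->
  (forall y, U y -> f y = g y) -> smooth U f -> smooth U g.
Proof. by move=> oU fg sf k; exact: eq_open_Ck (sf k). Qed.

Lemma smooth_eval U e : open U -> (forall x, U x -> dom e x) ->
  smooth U (eval e).
Proof.
move=> oU + k; elim: k e => [|k IH] e Ue /=; split => //.
- by move=> x /Ue; exact: continuous_eval.
- by move=> x /Ue; exact: continuous_eval.
move=> i; split=> [x /Ue|]; first exact: derivable_eval.
apply: (@eq_open_Ck _ _ (eval (deriv 'e_i e))) => //.
  by move=> y Uy; rewrite derive_eval //; exact: Ue.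
by apply: IH => x /Ue; exact: dom_deriv.
Qed.

End Elementary.
Arguments Cst {R m}.
Arguments Coord {R m}.

(** * Derivatives of determinants and inverse matrices *)

Section MatrixCalculus.
Variables (R : realType) (n : nat).
Implicit Types (A : 'rV[R]_n -> R).

Lemma derivable_bigsum (I : Type) (r : seq I) (F : I -> 'rV[R]_n -> R) x v :
  (forall i, derivable (F i) x v) ->
  derivable (fun y => \sum_(i <- r) F i y) x v.
Proof.
move=> dF; elim: r => [|i r IH].
  under eq_fun do rewrite big_nil; exact: (@derivable_cst R 'rV[R]_n R^o).
by under eq_fun do rewrite big_cons; exact: (derivableD (dF i) IH).
Qed.

Lemma derivable_bigprod (I : Type) (r : seq I) (F : I -> 'rV[R]_n -> R) x v :
  (forall i, derivable (F i) x v) ->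
  derivable (fun y => \prod_(i <- r) F i y) x v.
Proof.
move=> dF; elim: r => [|i r IH].
  under eq_fun do rewrite big_nil; exact: (@derivable_cst R 'rV[R]_n R^o).
by under eq_fun do rewrite big_cons; exact: (derivableM (dF i) IH).
Qed.

Lemma derivable_det m (A : 'rV[R]_n -> 'M[R]_m) x v :
  (forall i j, derivable (fun y => A y i j) x v) ->
  derivable (fun y => \det (A y)) x v.
Proof.
move=> dA; rewrite /determinant; apply: derivable_bigsum => s.
apply: derivableM; first exact: (@derivable_cst R 'rV[R]_n R^o).
exact: derivable_bigprod.
Qed.

(** Cramer's rule turns the inverse into a quotient of determinants, which are
    polynomial in the entries. *)
Lemma derivable_invmx m (U : set 'rV[R]_n) (A : 'rV[R]_n -> 'M[R]_m) x v i j :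
  open U -> (forall y, U y -> A y \in unitmx) -> U x ->
  (forall k l, derivable (fun y => A y k l) x v) ->
  derivable (fun y => invmx (A y) i j) x v.
Proof.
move=> oU uA Ux dA.
apply: (@eq_open_derivable _ _ U
  (fun y => (\det (A y))^-1 * cofactor (A y) j i)) => //.
  by move=> y /uA Ay; rewrite /invmx Ay !mxE.
apply: derivableM.
  apply: derivableV; last exact: derivable_det.
  by have := uA _ Ux; rewrite unitmxE unitfE.
apply: derivableM; first exact: (@derivable_cst R 'rV[R]_n R^o).
apply: derivable_det => k l.
by under eq_fun do rewrite !mxE; exact: dA.
Qed.

Lemma posdef_unitmx m (A : 'M[R]_m) : posdef A -> A \in unitmx.
Proof.
move=> [_ pA]; rewrite -row_free_unit; apply: inj_row_free => v vA.
apply/eqP; apply: contraT => /pA.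
by rewrite vA mul0mx mxE ltxx.
Qed.

Lemma posdef_block m (A : 'M[R]_m) : posdef A -> posdef (block_mx A 0 0 A).
Proof.
move=> [sA pA]; split; first by rewrite tr_block_mx !trmx0 sA.
move=> v v0.
have pA' (w : 'rV[R]_m) : 0 <= (w *m A *m w^T) 0 0.
  by have [->|/pA/ltW//] := eqVneq w 0; rewrite !mul0mx mxE.
rewrite -(hsubmxK v) mul_row_block !mulmx0 addr0 add0r tr_row_mx mul_row_col mxE.
have [l0|l0] := eqVneq (lsubmx v) 0; last by rewrite ltr_wpDr // pA.
rewrite ltr_wpDl // pA //; apply: contra v0 => /eqP r0.
by rewrite -(hsubmxK v) l0 r0 row_mx0.
Qed.

End MatrixCalculus.

(** * Kahler geometry of tube domains *)

Section TubeGeometry.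
Variables (R : realType) (n : nat).
Implicit Types (p q : 'rV[R]_(n + n)).

(** The two difference quotients are the same function.  In particular the
    derivatives along the imaginary directions of a tube vanish. *)
Lemma derive_lsubmx (f : 'rV[R]_n -> R) p v :
  'D_v (fun q : 'rV[R]_(n + n) => f (lsubmx q)) p = 'D_(lsubmx v) f (lsubmx p).
Proof.
rewrite /derive; set a := (fun h => _); set b := (fun h => _).
suff -> : a = b by [].
apply/funext => h; rewrite /a /b /=; congr (_ *: (f _ - _)).
by apply/rowP => i; rewrite !mxE.
Qed.

Lemma lsubmx_delta_l (i : 'I_n) : lsubmx ('e_(lshift n i) : 'rV[R]_(n + n)) = 'e_i.
Proof. by apply/rowP => j; rewrite !mxE (inj_eq (@lshift_inj _ _)). Qed.

Lemma lsubmx_delta_r (i : 'I_n) : lsubmx ('e_(rshift n i) : 'rV[R]_(n + n)) = 0.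
Proof. by apply/rowP => j; rewrite !mxE eq_lrshift andbF. Qed.

Lemma open_tube (U : set 'rV[R]_n) : open U -> open (tube U).
Proof.
move=> oU; apply: (@open_comp _ _ (lsubmx : 'rV[R]_(n + n) -> 'rV[R]_n) U) => //.
by move=> p _; exact: continuous_lsubmx.
Qed.

Variables (U : set 'rV[R]_n) (phi : elem R n).
Hypothesis oU : open U.
Hypothesis domU : forall x, U x -> dom phi x.

Definition partials (s : seq 'I_n) : elem R n :=
  foldr (fun i e => deriv 'e_i e) phi s.

Lemma dom_partials s x : U x -> dom (partials s) x.
Proof. by move=> Ux; elim: s => [|i s IH] /=; [exact: domU|exact: dom_deriv]. Qed.

Lemma derive_partials i s x : U x ->
  'D_'e_i (eval (partials s)) x = eval (partials (i :: s)) x.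
Proof. by move=> Ux; rewrite derive_eval //; exact: dom_partials. Qed.

(** The first index of [s] is moved to the front of [t] by successive uses of
    Schwarz's theorem. *)
Lemma perm_partials s t x : perm_eq s t -> U x ->
  eval (partials s) x = eval (partials t) x.
Proof.
have cons_eq i s1 s2 : (forall y, U y ->
    eval (partials s1) y = eval (partials s2) y) -> forall y, U y ->
    eval (partials (i :: s1)) y = eval (partials (i :: s2)) y.
  move=> e12 y Uy; rewrite -!derive_partials //.
  exact: (eq_open_derive _ oU e12 Uy).
have mid i s1 s2 : forall y, U y ->
    eval (partials (s1 ++ i :: s2)) y = eval (partials (i :: s1 ++ s2)) y.
  elim: s1 => [//|j s1 IH] y Uy; rewrite !cat_cons.
  by rewrite (cons_eq j _ _ IH) //= deriv_deriv.
elim: s t x => [|i s IH] t x; first by rewrite perm_sym => /perm_nilP ->.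
move=> st; have /splitPr tE : i \in t by rewrite -(perm_mem st) mem_head.
case: tE st => t1 t2 st Ux; rewrite mid //; apply: cons_eq => // y Uy.
apply: IH => //.
by rewrite -(perm_cons i) (perm_trans st) // perm_catC /= perm_cons perm_catC.
Qed.

(** A tube metric depends on its potential only through the Hessian.  Relating
    [F] and [phi] by their Hessians leaves room for the additive constants that
    Legendre duality produces. *)
Definition has_hess (F : 'rV[R]_n -> R) : Prop :=
  forall x i j, U x -> hess F x i j = eval (partials [:: i; j]) x.

Lemma has_hess_addc (F : 'rV[R]_n -> R) k :
  (forall x, U x -> F x = eval phi x + k) -> has_hess F.
Proof.
move=> Fphi x i j Ux; rewrite mxE -derive_partials //.
apply: (eq_open_derive _ oU _ Ux) => y Uy; rewrite -derive_partials //.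
transitivity ('D_'e_j (fun z => eval phi z + k) y).
  by apply: (eq_open_derive _ oU _ Uy) => z Uz; rewrite Fphi.
rewrite (deriveD (@derivable_eval _ _ _ _ _ (domU Uy))
  (@derivable_cst R _ R^o k y _)).
by rewrite (derive_cst (k : R^o)) addr0.
Qed.

Lemma has_hess_eval : has_hess (eval phi).
Proof. by apply: (@has_hess_addc _ 0) => x _; rewrite addr0. Qed.

Variable F : 'rV[R]_n -> R.
Hypothesis hessF : has_hess F.

Lemma tube_metricE p (i j : 'I_n) :
  ((tube_metric F p (lshift n i) (lshift n j) = hess F (lsubmx p) i j) *
   (tube_metric F p (lshift n i) (rshift n j) = 0) *
   (tube_metric F p (rshift n i) (lshift n j) = 0) *
   (tube_metric F p (rshift n i) (rshift n j) = hess F (lsubmx p) i j))%type.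
Proof.
by do !split; rewrite /tube_metric
  (block_mxEul, block_mxEur, block_mxEdl, block_mxEdr) ?mxE.
Qed.

Definition tube_elem (I J : 'I_(n + n)) : elem R (n + n) :=
  match fintype.split I, fintype.split J with
  | inl i, inl j | inr i, inr j => rename (lshift n) (partials [:: i; j])
  | _, _ => Cst 0
  end.

Lemma lsubmx_row p : \row_i p 0 (lshift n i) = lsubmx p.
Proof. by apply/rowP => i; rewrite !mxE. Qed.

Lemma tube_metric_elem p I J : tube U p ->
  tube_metric F p I J = eval (tube_elem I J) p.
Proof.
move=> Up; rewrite /tube_elem.
case: (split_ordP I) => i ->; case: (split_ordP J) => j ->.
all: by rewrite tube_metricE ?eval_rename ?lsubmx_row -?hessF.
Qed.

Lemma dom_tube_elem p I J : tube U p -> dom (tube_elem I J) p.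
Proof.
move=> Up; rewrite /tube_elem.
by case: (fintype.split I) => i; case: (fintype.split J) => j //;
  rewrite dom_rename lsubmx_row; exact: dom_partials.
Qed.

Lemma smooth_tube_metric : smooth_tensor (tube U) (tube_metric F).
Proof.
move=> I J; apply: (@eq_open_smooth _ _ _ (eval (tube_elem I J))).
- exact: open_tube.
- by move=> p Up; rewrite tube_metric_elem.
- by apply: smooth_eval; [exact: open_tube|move=> p; exact: dom_tube_elem].
Qed.

Lemma derive_hess i j x v : U x ->
  'D_v (fun y => hess F y i j) x = eval (deriv v (partials [:: i; j])) x.
Proof.
move=> Ux; rewrite -derive_eval; last exact: dom_partials.
by apply: (eq_open_derive _ oU _ Ux) => y Uy; rewrite hessF.
Qed.

Lemma derivable_hess i j x v : U x -> derivable (fun y => hess F y i j) x v.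
Proof.
move=> Ux; apply: (@eq_open_derivable _ _ U (eval (partials [:: i; j]))) => //.
  by move=> y Uy; rewrite hessF.
exact/derivable_eval/dom_partials.
Qed.

Lemma derivable_hess_lsubmx i j p v : tube U p ->
  derivable (fun q : 'rV[R]_(n + n) => hess F (lsubmx q) i j) p v.
Proof.
move=> Up; apply: (@eq_open_derivable _ _ (tube U)
  (eval (rename (lshift n) (partials [:: i; j])))) => //.
- exact: open_tube.
- by move=> q Uq; rewrite eval_rename lsubmx_row hessF.
- by apply: derivable_eval; rewrite dom_rename lsubmx_row; exact: dom_partials.
Qed.

Lemma deriv0 (e : elem R n) x : eval (deriv 0 e) x = 0.
Proof. by rewrite deriv_sum big1 // => i _; rewrite mxE mul0r. Qed.

Lemma derive_hess_l k i j p : tube U p ->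
  'D_'e_(lshift n k) (fun q => hess F (lsubmx q) i j) p
  = eval (partials [:: k; i; j]) (lsubmx p).
Proof.
move=> Up.
by rewrite (derive_lsubmx (fun y => hess F y i j)) derive_hess // lsubmx_delta_l.
Qed.

Lemma derive_hess_r k i j p : tube U p ->
  'D_'e_(rshift n k) (fun q => hess F (lsubmx q) i j) p = 0.
Proof.
move=> Up; rewrite (derive_lsubmx (fun y => hess F y i j)) derive_hess //.
by rewrite lsubmx_delta_r deriv0.
Qed.

Lemma kahler_formE p : kahler_form (tube_metric F) p =
  block_mx 0 (hess F (lsubmx p)) (- hess F (lsubmx p)) 0.
Proof.
rewrite /kahler_form /complex_str /tube_metric mulmx_block.
by rewrite !mul0mx !mulmx0 !addr0 !add0r mul1mx mulNmx mul1mx.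
Qed.

Lemma derive_tube_metric p v (i j : 'I_n) :
  (('D_v (fun q => tube_metric F q (lshift n i) (lshift n j)) p
      = 'D_v (fun q => hess F (lsubmx q) i j) p) *
   ('D_v (fun q => tube_metric F q (lshift n i) (rshift n j)) p = 0) *
   ('D_v (fun q => tube_metric F q (rshift n i) (lshift n j)) p = 0) *
   ('D_v (fun q => tube_metric F q (rshift n i) (rshift n j)) p
      = 'D_v (fun q => hess F (lsubmx q) i j) p))%type.
Proof.
have d0 : 'D_v (fun=> 0 : R) p = 0 by exact: (derive_cst (0 : R^o)).
by do !split; rewrite -?[RHS]d0; congr ('D_v _ p); apply/funext => q;
  rewrite tube_metricE.
Qed.

Lemma derive_kahler_form p : tube U p -> forall v (i j : 'I_n),
  (('D_v (fun q => kahler_form (tube_metric F) q (lshift n i) (lshift n j)) p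
      = 0) *
   ('D_v (fun q => kahler_form (tube_metric F) q (lshift n i) (rshift n j)) p
      = 'D_v (fun q => hess F (lsubmx q) i j) p) *
   ('D_v (fun q => kahler_form (tube_metric F) q (rshift n i) (lshift n j)) p
      = - 'D_v (fun q => hess F (lsubmx q) i j) p) *
   ('D_v (fun q => kahler_form (tube_metric F) q (rshift n i) (rshift n j)) p
      = 0))%type.
Proof.
move=> Up v i j.
have d0 : 'D_v (fun=> 0 : R) p = 0 by exact: (derive_cst (0 : R^o)).
rewrite -(deriveN (@derivable_hess_lsubmx i j p v Up)).
do !split; rewrite -?[RHS]d0; congr ('D_v _ p); apply/funext => q;
  rewrite kahler_formE.
- by rewrite block_mxEul mxE.
- by rewrite block_mxEur.
- by rewrite block_mxEdl mxE.
- by rewrite block_mxEdr mxE.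
Qed.

Lemma rot_partials i j k x : U x ->
  eval (partials [:: k; i; j]) x = eval (partials [:: i; j; k]) x.
Proof. by apply: perm_partials; rewrite (perm_catC [:: k] [:: i; j]). Qed.

(** With exactly one imaginary index among [a], [b], [c], the cyclic sum is a
    difference of two third derivatives of the potential; in the other cases
    all its terms vanish. *)
Lemma closed_kahler_form p : tube U p -> closed_form (kahler_form (tube_metric F)) p.
Proof.
move=> Up a b c.
case: (split_ordP a) => i ->; case: (split_ordP b) => j ->;
  case: (split_ordP c) => k ->.
all: rewrite !(derive_kahler_form Up) ?derive_hess_l ?derive_hess_r //.
all: rewrite ?oppr0 ?addr0 ?add0r // ?(@rot_partials i j) //.
all: rewrite ?(@rot_partials j k) ?subrr ?addNr //.
Qed.

Hypothesis pd : forall x, U x -> posdef (hess F x).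

Lemma kahler_tube : kahler_manifold (tube U) (tube_metric F).
Proof.
split; first exact: open_tube.
- exact: smooth_tube_metric.
- by move=> p Up; exact/posdef_block/pd.
- move=> p Up; rewrite /complex_str /tube_metric.
  rewrite tr_block_mx !trmx0 raddfN /= trmx1 !mulmx_block.
  by rewrite !(mul0mx, mulmx0, addr0, add0r, mul1mx, mulmx1, mulNmx,
    mulmxN, opprK, oppr0).
- exact: closed_kahler_form.
Qed.

(** Half of the third derivatives with one index raised: the Christoffel
    symbols of the Hessian metric on the base, and also the holomorphic
    Christoffel symbols of the Kahler metric on the tube. *)
Definition base_christoffel (k i j : 'I_n) (x : 'rV[R]_n) : R :=
  2^-1 * \sum_l invmx (hess F x) k l * eval (partials [:: l; i; j]) x.

End TubeGeometry.

(** * Curvature of tube domains *)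

Section TubeRicci.
Variables (R : realType) (n : nat).
Implicit Types (p q : 'rV[R]_(n + n)).
Variables (U : set 'rV[R]_n) (F : 'rV[R]_n -> R) (phi : elem R n).
Hypothesis oU : open U.
Hypothesis domU : forall x, U x -> dom phi x.
Hypothesis hessF : has_hess U phi F.
Hypothesis pd : forall x, U x -> posdef (hess F x).
Local Notation T s := (eval (partials phi s)).
Local Notation C := (base_christoffel phi F).
Local Notation G := (christoffel (tube_metric F)).

(** A symbol with an odd number of imaginary indices vanishes because the
    metric is block diagonal and does not depend on the imaginary part; the
    others agree up to sign because the metric is Kahler. *)
Lemma christoffel_tube p : tube U p -> forall k i j : 'I_n,
  ((G (lshift n k) (lshift n i) (lshift n j) p = C k i j (lsubmx p)) *
   (G (lshift n k) (lshift n i) (rshift n j) p = 0) *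
   (G (lshift n k) (rshift n i) (lshift n j) p = 0) *
   (G (lshift n k) (rshift n i) (rshift n j) p = - C k i j (lsubmx p)) *
   (G (rshift n k) (lshift n i) (lshift n j) p = 0) *
   (G (rshift n k) (lshift n i) (rshift n j) p = C k i j (lsubmx p)) *
   (G (rshift n k) (rshift n i) (lshift n j) p = C k i j (lsubmx p)) *
   (G (rshift n k) (rshift n i) (rshift n j) p = 0))%type.
Proof.
move=> Up k i j.
have invE : invmx (tube_metric F p)
    = block_mx (invmx (hess F (lsubmx p))) 0 0 (invmx (hess F (lsubmx p))).
  by apply: invmx_block_diag; exact/posdef_unitmx/posdef_block/pd.
have z (a b : 'I_n) : (0 : 'M[R]_n) a b = 0 by rewrite mxE.
pose X (a b c : 'I_(n + n)) := 'D_'e_a (fun q => tube_metric F q b c) p.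
have GE (a b c : 'I_(n + n)) : G a b c p = 2^-1 * (
    \sum_l invmx (tube_metric F p) a (lshift n l) *
      (X b c (lshift n l) + X c b (lshift n l) - X (lshift n l) b c)
    + \sum_l invmx (tube_metric F p) a (rshift n l) *
      (X b c (rshift n l) + X c b (rshift n l) - X (rshift n l) b c)).
  by rewrite /christoffel big_split_ord.
have XE a b c :
  ((X (lshift n a) (lshift n b) (lshift n c) = T [:: a; b; c] (lsubmx p)) *
   (X (lshift n a) (lshift n b) (rshift n c) = 0) *
   (X (lshift n a) (rshift n b) (lshift n c) = 0) *
   (X (lshift n a) (rshift n b) (rshift n c) = T [:: a; b; c] (lsubmx p)) *
   (X (rshift n a) (lshift n b) (lshift n c) = 0) *
   (X (rshift n a) (lshift n b) (rshift n c) = 0) *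
   (X (rshift n a) (rshift n b) (lshift n c) = 0) *
   (X (rshift n a) (rshift n b) (rshift n c) = 0))%type.
  rewrite /X !derive_tube_metric.
  by rewrite !(derive_hess_l oU domU hessF) // !(derive_hess_r oU domU hessF).
have z0 (u v : 'I_n -> R) : (forall l, u l = 0) -> \sum_l u l * v l = 0.
  by move=> u0; rewrite big1 // => l _; rewrite u0 mul0r.
have z1 (u v : 'I_n -> R) : (forall l, v l = 0) -> \sum_l u l * v l = 0.
  by move=> v0; rewrite big1 // => l _; rewrite v0 mulr0.
have rot a b c : T [:: c; a; b] (lsubmx p) = T [:: a; b; c] (lsubmx p).
  exact: (rot_partials oU domU).
have swp a b c : T [:: b; a; c] (lsubmx p) = T [:: a; b; c] (lsubmx p).
  by apply: (perm_partials oU domU) => //; rewrite (perm_catCA [:: b] [:: a] [:: c]).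
do !split; rewrite GE invE.
- rewrite [X in _ + X]z0; last by move=> l; rewrite block_mxEur z.
  rewrite addr0; congr (_ * _); apply: eq_bigr => l _.
  by rewrite block_mxEul !XE (swp i j l) (rot i j l) addrK.
- rewrite [X in _ + X]z0; last by move=> l; rewrite block_mxEur z.
  rewrite addr0 [X in _ * X]z1 ?mulr0 // => l.
  by rewrite !XE subr0 addr0.
- rewrite [X in _ + X]z0; last by move=> l; rewrite block_mxEur z.
  rewrite addr0 [X in _ * X]z1 ?mulr0 // => l.
  by rewrite !XE subr0 addr0.
- rewrite [X in _ + X]z0; last by move=> l; rewrite block_mxEur z.
  rewrite addr0 -mulrN -sumrN; congr (_ * _); apply: eq_bigr => l _.
  by rewrite block_mxEul !XE addr0 sub0r mulrN.
- rewrite [X in X + _]z0; last by move=> l; rewrite block_mxEdl z.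
  rewrite add0r [X in _ * X]z1 ?mulr0 // => l.
  by rewrite !XE subr0 addr0.
- rewrite [X in X + _]z0; last by move=> l; rewrite block_mxEdl z.
  rewrite add0r; congr (_ * _); apply: eq_bigr => l _.
  by rewrite block_mxEdr !XE addr0 subr0 -(rot i j l).
- rewrite [X in X + _]z0; last by move=> l; rewrite block_mxEdl z.
  rewrite add0r; congr (_ * _); apply: eq_bigr => l _.
  by rewrite block_mxEdr !XE add0r subr0 (swp i j l) -(rot i j l).
- rewrite [X in X + _]z0; last by move=> l; rewrite block_mxEdl z.
  rewrite add0r [X in _ * X]z1 ?mulr0 // => l.
  by rewrite !XE subr0 addr0.
Qed.

Lemma derivable_base_christoffel k i j x v : U x -> derivable (C k i j) x v.
Proof.
move=> Ux; apply: derivableM; first exact: (@derivable_cst R 'rV[R]_n R^o).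
apply: derivable_bigsum => l; apply: derivableM.
  apply: (@derivable_invmx R n n U (hess F) x v k l oU) => // [y Uy|a b].
    exact/posdef_unitmx/pd.
  exact: (derivable_hess oU domU hessF).
exact/derivable_eval/(dom_partials domU).
Qed.

(** This linear relation, rather than the formula for the derivative of an
    inverse matrix, is what gets differentiated below. *)
Lemma hess_base_christoffel m i j x : U x ->
  \sum_k hess F x m k * C k i j x = 2^-1 * T [:: m; i; j] x.
Proof.
move=> Ux; under eq_bigr do rewrite mulrCA mulr_sumr.
rewrite -mulr_sumr exchange_big /=; congr (_ * _).
under eq_bigr do under eq_bigr do rewrite mulrA.
under eq_bigr do rewrite -mulr_suml.
have HV l : \sum_k hess F x m k * invmx (hess F x) k l = (m == l)%:R.
  have := mulmxV (posdef_unitmx (pd Ux)) => /matrixP/(_ m l).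
  by rewrite !mxE.
under eq_bigr do rewrite HV.
rewrite (bigD1 m) //= eqxx mul1r big1 ?addr0 // => l /negbTE.
by rewrite eq_sym => ->; rewrite mul0r.
Qed.

Lemma derive_base_christoffel a k i j x : U x -> 'D_'e_a (C k i j) x =
  2^-1 * \sum_l invmx (hess F x) k l * T [:: a; l; i; j] x
  - 2 * \sum_l C k a l x * C l i j x.
Proof.
move=> Ux; set dC := fun k => 'D_'e_a (C k i j) x.
have HdC m : \sum_l hess F x m l * dC l
    = 2^-1 * T [:: a; m; i; j] x - \sum_l C l i j x * T [:: a; m; l] x.
  have dhC l : derivable (fun y => hess F y m l * C l i j y) x 'e_a.
    apply: derivableM; first exact: (derivable_hess oU domU hessF).
    exact: derivable_base_christoffel.
  have dT : derivable (T [:: m; i; j]) x 'e_a.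
    exact/derivable_eval/(dom_partials domU).
  transitivity ('D_'e_a (fun y => \sum_l hess F y m l * C l i j y) x
      - \sum_l C l i j x * T [:: a; m; l] x).
    rewrite (_ : (fun y => _)
      = \sum_l (fun y => hess F y m l * C l i j y)); last first.
      by apply/funext => y; rewrite fct_sumE.
    rewrite derive_sum // -sumrB; apply: eq_bigr => l _.
    have dh : derivable (fun y => hess F y m l) x 'e_a.
      exact: (derivable_hess oU domU hessF).
    rewrite (deriveM dh (@derivable_base_christoffel l i j x 'e_a Ux)).
    by rewrite (derive_hess oU domU hessF) // addrK.
  congr (_ - _).
  transitivity ('D_'e_a (fun y => 2^-1 * T [:: m; i; j] y) x).
    by apply: (eq_open_derive _ oU _ Ux) => y Uy; rewrite hess_base_christoffel.
  by rewrite (deriveZ 2^-1 dT) (derive_partials domU).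
have VH l : \sum_m invmx (hess F x) k m * hess F x m l = (k == l)%:R.
  have := mulVmx (posdef_unitmx (pd Ux)) => /matrixP/(_ k l).
  by rewrite !mxE.
transitivity (\sum_m invmx (hess F x) k m * \sum_l hess F x m l * dC l).
  under eq_bigr do rewrite mulr_sumr; rewrite exchange_big /=.
  under eq_bigr do under eq_bigr do rewrite mulrA.
  under eq_bigr do rewrite -mulr_suml VH.
  rewrite (bigD1 k) //= eqxx mul1r big1 ?addr0 // => l /negbTE.
  by rewrite eq_sym => ->; rewrite mul0r.
under eq_bigr do rewrite HdC mulrBr.
rewrite sumrB; congr (_ - _).
  by rewrite mulr_sumr; apply: eq_bigr => m _; rewrite mulrCA.
under eq_bigr do rewrite mulr_sumr; rewrite exchange_big mulr_sumr /=.
apply: eq_bigr => l _; rewrite [RHS]mulrA.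
have -> : 2 * C k a l x = \sum_m invmx (hess F x) k m * T [:: m; a; l] x.
  by rewrite /base_christoffel mulrA divff ?pnatr_eq0 // mul1r.
rewrite mulr_suml; apply: eq_bigr => m _; rewrite -[RHS]mulrA; congr (_ * _).
rewrite [LHS]mulrC; congr (_ * _).
apply: (@perm_partials _ _ _ _ oU domU [:: a; m; l]) => //.
by rewrite (perm_catCA [:: a] [:: m] [:: l]).
Qed.

(** By Jacobi's formula, the partial derivative of [(1/2) ln det Hess F]. *)
Definition christoffel_trace (i : 'I_n) (x : 'rV[R]_n) : R := \sum_k C k i k x.

Lemma derive_christoffel_trace i j x : U x ->
  'D_'e_j (christoffel_trace i) x = \sum_k 'D_'e_j (C k i k) x.
Proof.
move=> Ux; rewrite (_ : christoffel_trace i = \sum_k C k i k); last first.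
  by apply/funext => y; rewrite fct_sumE.
by rewrite derive_sum // => k; exact: derivable_base_christoffel.
Qed.

(** The sum on the right is, up to sign, the Ricci tensor in the imaginary
    directions.  The fourth derivatives of the potential that appear on both
    sides are equal by symmetry. *)
Lemma derive_christoffel_traceE i j x : U x -> 'D_'e_j (christoffel_trace i) x =
  \sum_k ('D_'e_k (C k i j) x
          + 2 * \sum_l (C k k l x * C l i j x - C k j l x * C l i k x)).
Proof.
move=> Ux; rewrite derive_christoffel_trace //; apply: eq_bigr => k _.
rewrite !derive_base_christoffel // sumrB mulrBr addrA subrK; congr (_ * _ - _).
apply: eq_bigr => l _; congr (_ * _).
apply: (@perm_partials _ _ _ _ oU domU [:: j; l; i; k]) => //.
by apply/allP => a; rewrite !inE /= => _; rewrite eqn_leq; lia.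
Qed.

(** In the imaginary directions the Ricci tensor is minus the right-hand side
    of [derive_christoffel_traceE]; in the real directions it is this same sum
    minus twice the derivative of the trace. *)
Lemma ricci_tube p : tube U p -> ricci (tube_metric F) p =
  block_mx (- \matrix_(i, j) 'D_'e_j (christoffel_trace i) (lsubmx p)) 0 0
           (- \matrix_(i, j) 'D_'e_j (christoffel_trace i) (lsubmx p)).
Proof.
move=> Up; have GE := christoffel_tube Up.
pose DG (a b c d : 'I_(n + n)) := 'D_'e_a (G b c d) p.
pose D a k i j := 'D_'e_a (C k i j) (lsubmx p).
have dl v (g : 'rV[R]_(n + n) -> R) k i j :
    (forall q, tube U q -> g q = C k i j (lsubmx q)) ->
    'D_v g p = 'D_(lsubmx v) (C k i j) (lsubmx p).
  move=> gC; rewrite -derive_lsubmx.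
  exact: (eq_open_derive _ (open_tube oU) gC Up).
have dlN v (g : 'rV[R]_(n + n) -> R) k i j :
    (forall q, tube U q -> g q = - C k i j (lsubmx q)) ->
    'D_v g p = - 'D_(lsubmx v) (C k i j) (lsubmx p).
  move=> gC; rewrite -deriveN; last exact: derivable_base_christoffel.
  rewrite -(derive_lsubmx (- C k i j)).
  exact: (eq_open_derive _ (open_tube oU) gC Up).
have d0 v (g : 'rV[R]_(n + n) -> R) :
    (forall q, tube U q -> g q = 0) -> 'D_v g p = 0.
  move=> g0; transitivity ('D_v (fun=> 0 : R) p); last exact: (derive_cst (0 : R^o)).
  exact: (eq_open_derive _ (open_tube oU) g0 Up).
have DGE (a k i j : 'I_n) :
  ((DG (lshift n a) (lshift n k) (lshift n i) (lshift n j) = D a k i j) *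
   (DG (lshift n a) (lshift n k) (rshift n i) (rshift n j) = - D a k i j) *
   (DG (lshift n a) (rshift n k) (lshift n i) (rshift n j) = D a k i j) *
   (DG (lshift n a) (rshift n k) (rshift n i) (lshift n j) = D a k i j))%type.
  by do !split; [apply: etrans (dl _ _ k i j _) _ | apply: etrans (dlN _ _ k i j _) _
    | apply: etrans (dl _ _ k i j _) _ | apply: etrans (dl _ _ k i j _) _];
    rewrite ?lsubmx_delta_l // => q Uq; rewrite christoffel_tube.
have DG0 a (k i j : 'I_n) :
  ((DG a (lshift n k) (lshift n i) (rshift n j) = 0) *
   (DG a (lshift n k) (rshift n i) (lshift n j) = 0) *
   (DG a (rshift n k) (lshift n i) (lshift n j) = 0) *
   (DG a (rshift n k) (rshift n i) (rshift n j) = 0))%type.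
  by do !split; apply: d0 => q Uq; rewrite christoffel_tube.
have DGr a b c d : DG (rshift n a) b c d = 0.
  case: (split_ordP b) => k ->; case: (split_ordP c) => i ->;
    case: (split_ordP d) => j ->; rewrite ?DG0 //.
  - apply: etrans (dl _ _ k i j _) _; last by rewrite lsubmx_delta_r derive0.
    by move=> q Uq; rewrite christoffel_tube.
  - apply: etrans (dlN _ _ k i j _) _; last by rewrite lsubmx_delta_r derive0 oppr0.
    by move=> q Uq; rewrite christoffel_tube.
  - apply: etrans (dl _ _ k i j _) _; last by rewrite lsubmx_delta_r derive0.
    by move=> q Uq; rewrite christoffel_tube.
  - apply: etrans (dl _ _ k i j _) _; last by rewrite lsubmx_delta_r derive0.
    by move=> q Uq; rewrite christoffel_tube.
pose S (I J K L : 'I_(n + n)) := G K K L p * G L I J p - G K J L p * G L I K p.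
have ricE (I J : 'I_(n + n)) : ricci (tube_metric F) p I J = \sum_k
    (DG (lshift n k) (lshift n k) I J - DG J (lshift n k) I (lshift n k)
     + (DG (rshift n k) (rshift n k) I J - DG J (rshift n k) I (rshift n k))
     + \sum_l (S I J (lshift n k) (lshift n l) + S I J (lshift n k) (rshift n l)
               + (S I J (rshift n k) (lshift n l)
                  + S I J (rshift n k) (rshift n l)))).
  rewrite mxE big_split_ord /= -big_split /=; apply: eq_bigr => k _.
  by rewrite !big_split_ord /= addrACA !big_split.
pose traceE i j := derive_christoffel_traceE i j Up.
apply/matrixP => I J.
case: (split_ordP I) => i ->; case: (split_ordP J) => j ->; rewrite ricE /S.
all: rewrite ?block_mxEul ?block_mxEur ?block_mxEdl ?block_mxEdr.
- rewrite [RHS]mxE [X in - X]mxE.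
  transitivity ('D_'e_j (christoffel_trace i) (lsubmx p)
    - 2 * 'D_'e_j (christoffel_trace i) (lsubmx p)); last by ring.
  rewrite [X in X - _]traceE derive_christoffel_trace // mulr_sumr -sumrB.
  apply: eq_bigr => k _.
  rewrite !(DGE, DG0, DGr) -/(D k k i j) -/(D j k i k).
  have -> : D k k i j - D j k i k + (0 - D j k i k)
    = D k k i j - 2 * D j k i k by ring.
  rewrite addrAC; congr (_ + _ - _); rewrite mulr_sumr; apply: eq_bigr => l _.
  rewrite !GE; ring.
- rewrite mxE big1 // => k _.
  rewrite !(DGE, DG0, DGr) big1 ?(subr0, addr0) // => l _; rewrite !GE; ring.
- rewrite mxE big1 // => k _.
  rewrite !(DGE, DG0, DGr) big1 ?(subr0, addr0) // => l _; rewrite !GE; ring.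
- rewrite [RHS]mxE [X in - X]mxE traceE -sumrN; apply: eq_bigr => k _.
  rewrite !(DGE, DG0, DGr) -/(D k k i j) opprD !subr0 addr0; congr (_ + _).
  rewrite -mulrN -sumrN mulr_sumr; apply: eq_bigr => l _.
  rewrite !GE; ring.
Qed.

End TubeRicci.

(** * Solitons and flows on tube domains *)

Section LinearField.
Variables (R : realType) (m : nat) (L : 'M[R]_m).

Lemma jacobian_linear p : 'J (fun q : 'rV[R]_m => q *m L) p = L.
Proof.
have dV q : differentiable (fun x : 'rV[R]_m => x *m L) q.
  under eq_fun do rewrite mulmx_sum_row.
  rewrite (_ : (fun x => _)
    = \sum_i (fun x : 'rV[R]_m => x 0 i *: row i L)); last first.
    by apply/funext => x; rewrite fct_sumE.
  apply: differentiable_sum => i; apply: differentiableZl.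
  exact: differentiable_coord.
rewrite /jacobian (_ : (fun q => _) = mulmxr L) // diff_lin; last first.
  by move=> q; exact/differentiable_continuous/dV.
apply/row_matrixP => i.
by rewrite rowE mul_rV_lin1 /= rowE.
Qed.

Lemma smooth_linear (U : set 'rV[R]_m) : open U ->
  smooth_vfield U (fun q => q *m L).
Proof.
move=> oU i; pose e := \big[@Add R m/Cst 0]_j Mul (Coord j) (Cst (L j i)).
have eE x : eval e x = (x *m L) 0 i.
  rewrite mxE /e; elim/big_rec2: _ => //= j y f _ ->; rewrite addrC.
  by rewrite addrC.
have de x : dom e x by rewrite /e; elim/big_rec: _ => //=.
apply: (@eq_open_smooth _ _ _ (eval e)) => //; exact: smooth_eval.
Qed.

End LinearField.

Section Solitons.
Variables (R : realType) (n : nat).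

Lemma soliton_linear (M : set 'rV[R]_(n + n)) g (lambda : R) (L : 'M[R]_(n + n)) :
  kahler_manifold M g -> L *m complex_str R n = complex_str R n *m L ->
  (forall p, M p -> ricci g p = lambda *: g p
     + (\matrix_(a, b) 'D_(p *m L) (fun x => g x a b) p + L *m g p + g p *m L^T)) ->
  kr_soliton M g.
Proof.
move=> kM LJ ric; split => //; exists lambda, (fun q => q *m L).
have [oM _ _ _ _] := kM; split; first exact: smooth_linear.
- move=> p Mp; rewrite /lie_endo jacobian_linear LJ addrK.
  by apply/matrixP => i j; rewrite !mxE (derive_cst (_ : R^o)).
- by move=> p Mp; rewrite ric // /lie_form jacobian_linear.
Qed.

End Solitons.

Section Flow.
Variables (R : realType) (n : nat) (U : set 'rV[R]_n).
Hypothesis oU : open U.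
Variables (A B : elem R n) (kappa : R).

(** The flow equation is linear on a pencil [A + c B] when [ln det Hess] of
    its members is, up to constants, a fixed multiple of [B]. *)
Definition pencil (c : R) : elem R n := Add A (Mul (Cst c) B).

Hypothesis domA : forall x, U x -> dom A x.
Hypothesis domB : forall x, U x -> dom B x.

Lemma dom_pencil c x : U x -> dom (pencil c) x.
Proof. by move=> Ux; split; [exact: domA | split => //; exact: domB]. Qed.

Lemma has_hess_pencil c : has_hess U (pencil c) (eval (pencil c)).
Proof. by apply: has_hess_eval => // x; exact: dom_pencil. Qed.

Lemma partials_pencil c i j x : eval (partials (pencil c) [:: i; j]) x
  = eval (partials A [:: i; j]) x + c * eval (partials B [:: i; j]) x.
Proof. by rewrite /= !(mulr0, mul0r, addr0). Qed.

Lemma hess_pencil c x : U x ->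
  hess (eval (pencil c)) x = hess (eval A) x + c *: hess (eval B) x.
Proof.
move=> Ux; apply/matrixP => i j; rewrite [RHS]mxE [X in _ + X]mxE.
transitivity (eval (partials A [:: i; j]) x + c * eval (partials B [:: i; j]) x).
  exact: etrans (has_hess_pencil _ _ _ Ux) (partials_pencil _ _ _ _).
congr (_ + _ * _); apply/esym.
  exact: (has_hess_eval oU domA).
exact: (has_hess_eval oU domB).
Qed.

Lemma tube_pencil c p : tube U p -> tube_metric (eval (pencil c)) p =
  tube_metric (eval A) p + c *: tube_metric (eval B) p.
Proof.
move=> Up; rewrite /tube_metric hess_pencil // scale_block_mx add_block_mx.
by rewrite !scaler0 !addr0.
Qed.

Lemma tube_pencilE c p I J : tube U p -> tube_metric (eval (pencil c)) p I J =
  eval (tube_elem A I J) p + c * eval (tube_elem B I J) p.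
Proof.
move=> Up; rewrite tube_pencil //.
have eA := tube_metric_elem (has_hess_eval oU domA) I J Up.
have eB := tube_metric_elem (has_hess_eval oU domB) I J Up.
by rewrite -eA -eB [LHS]mxE; congr (_ + _); rewrite [LHS]mxE.
Qed.

(** The trace hypothesis says that [ln det Hess F] is [2 kappa B] up to a
    constant. *)
Lemma ricci_christoffel_trace (F : 'rV[R]_n -> R) phi p :
  (forall y, U y -> dom phi y) -> has_hess U phi F ->
  (forall y, U y -> posdef (hess F y)) ->
  (forall i y, U y -> christoffel_trace F phi i y = kappa * eval (deriv 'e_i B) y) ->
  tube U p -> ricci (tube_metric F) p = - kappa *: tube_metric (eval B) p.
Proof.
move=> dphi hessF pd tauE Up; rewrite (ricci_tube oU dphi hessF pd Up).
rewrite /tube_metric scale_block_mx !scaler0.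
suff -> : - \matrix_(i, j) 'D_'e_j (christoffel_trace F phi i) (lsubmx p)
  = - kappa *: hess (eval B) (lsubmx p) by [].
apply/matrixP => i j; rewrite mxE [RHS]mxE mxE (has_hess_eval oU domB) //.
rewrite mulNr; congr (- _).
have dBi : dom (deriv 'e_i B) (lsubmx p) by exact/dom_deriv/domB.
transitivity ('D_'e_j (fun y => kappa * eval (deriv 'e_i B) y) (lsubmx p)).
  by apply: (eq_open_derive _ oU _ Up) => y Uy; rewrite tauE.
rewrite (deriveZ kappa (@derivable_eval _ _ _ _ 'e_j dBi)) derive_eval //.
by rewrite deriv_deriv.
Qed.

Hypothesis pd : forall c x, 0 < c -> U x -> posdef (hess (eval (pencil c)) x).
Hypothesis tauE : forall c i x, 0 < c -> U x ->
  christoffel_trace (eval (pencil c)) (pencil c) i x = kappa * eval (deriv 'e_i B) x.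
Variable c0 : R.
Hypotheses (c0_gt0 : 0 < c0) (kappa_ge0 : 0 <= kappa).

(** The Ricci tensor is the same along the pencil, so the flow equation asks
    for [c] to grow at the constant rate [2 kappa]. *)
Lemma krf_pencil : krf_solution (tube U)
  (fun t => tube_metric (eval (pencil (c0 + 2 * kappa * t)))).
Proof.
have ct_gt0 t : 0 <= t -> 0 < c0 + 2 * kappa * t.
  by move=> t0; rewrite ltr_wpDr // mulr_ge0 // mulr_ge0.
split.
- move=> t t0; apply: (kahler_tube oU _ (@has_hess_pencil (c0 + 2 * kappa * t))).
    by move=> x; exact: dom_pencil.
  by move=> x Ux; apply: pd => //; exact: ct_gt0.
- move=> I J q [_ Uq].
  pose lift_time (e : elem R (n + n)) : elem R (1 + (n + n)) :=
    rename (@rshift 1 (n + n)) e.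
  pose E := Add (lift_time (tube_elem A I J))
    (Mul (Add (Cst c0) (Mul (Cst (2 * kappa)) (Coord (lshift (n + n) (0 : 'I_1)))))
       (lift_time (tube_elem B I J))).
  have rE (q' : 'rV[R]_(1 + (n + n))) : \row_i q' 0 (rshift 1 i) = rsubmx q'.
    by apply/rowP => i; rewrite !mxE.
  have oW : open [set q' : 'rV[R]_(1 + (n + n)) | tube U (rsubmx q')].
    apply: (@open_comp _ _
      (rsubmx : 'rV[R]_(1 + (n + n)) -> 'rV[R]_(n + n)) (tube U)).
      by move=> p _; exact: continuous_rsubmx.
    exact: open_tube.
  exists [set q' : 'rV[R]_(1 + (n + n)) | tube U (rsubmx q')], (eval E); split => //.
    apply: smooth_eval => // q' Uq'.
    by rewrite /E /lift_time /= !dom_rename !rE; do !split => //;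
      apply: (@dom_tube_elem _ _ U).
  move=> q' Uq' _; rewrite tube_pencilE // /E /lift_time /= !eval_rename rE.
  by rewrite [lsubmx q' 0 0]mxE.
- move=> t p t0 Up.
  have -> : (-2) *: ricci (tube_metric (eval (pencil (c0 + 2 * kappa * t)))) p
      = (2 * kappa) *: tube_metric (eval B) p.
    rewrite (@ricci_christoffel_trace _ (pencil (c0 + 2 * kappa * t))) //.
    + by rewrite scalerA; congr (_ *: _); ring.
    + by move=> x; exact: dom_pencil.
    + exact: has_hess_pencil.
    + by move=> x Ux; apply: pd => //; exact: ct_gt0.
    + by move=> i x Ux; apply: tauE => //; exact: ct_gt0.
  (* The metric is affine in time: the difference quotient is constant. *)
  apply: cvg_near_cst; rewrite near_withinE; near=> s => _.
  rewrite !tube_pencil // opprD addrACA subrr add0r -scalerBl scalerA.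
  congr (_ *: _).
  have st : s - t != 0 by rewrite subr_eq0; near: s; exact: nbhs_dnbhs_neq.
  by field.
Unshelve. all: by end_near.
Qed.

End Flow.

Section TubeSolitons.
Variables (R : realType) (n : nat).

(** The additive constant cancels in the difference quotients, so this holds
    at every point. *)
Lemma tube_metric_addc (F : 'rV[R]_n -> R) k :
  tube_metric (fun x => F x + k) = tube_metric F.
Proof.
have dk i : 'D_'e_i (fun x => F x + k) = 'D_'e_i F :> ('rV[R]_n -> R).
  apply/funext => x; rewrite /derive; set a := (fun h => _); set b := (fun h => _).
  suff -> : a = b by [].
  by apply/funext => h; rewrite /a /b /= opprD addrACA subrr addr0.
have hk : hess (fun x => F x + k) = hess F :> ('rV[R]_n -> 'M[R]_n).
  apply/funext => x; apply/matrixP => i j; rewrite [LHS]mxE [RHS]mxE.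
  by congr ('D_'e_i _ x); exact: dk.
by apply/funext => p; rewrite /tube_metric hk.
Qed.

Lemma eq_tube_metric (U : set 'rV[R]_n) phi (F G : 'rV[R]_n -> R) p :
  has_hess U phi F -> has_hess U phi G -> tube U p ->
  tube_metric F p = tube_metric G p.
Proof.
move=> hF hG Up; rewrite /tube_metric.
suff -> : hess F (lsubmx p) = hess G (lsubmx p) by [].
by apply/matrixP => i j; apply: etrans (hF _ i j Up) _; apply/esym; exact: hG.
Qed.

(** The linear field that acts by [D] on the real and on the imaginary part is
    holomorphic because [D] is real. *)
Lemma soliton_tube (U : set 'rV[R]_n) (F : 'rV[R]_n -> R) phi (B : elem R n)
    (kappa lambda : R) (D : 'M[R]_n) :
  open U -> (forall x, U x -> dom phi x) -> has_hess U phi F ->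
  (forall x, U x -> dom B x) -> (forall x, U x -> posdef (hess F x)) ->
  (forall i x, U x -> christoffel_trace F phi i x = kappa * eval (deriv 'e_i B) x) ->
  (forall x, U x -> - kappa *: hess (eval B) x = lambda *: hess F x
     + (\matrix_(i, j) eval (deriv (x *m D) (partials phi [:: i; j])) x
        + D *m hess F x + hess F x *m D^T)) ->
  kr_soliton (tube U) (tube_metric F).
Proof.
move=> oU dphi hessF dB pd tauE sol.
apply: (@soliton_linear _ _ _ _ lambda (block_mx D 0 0 D)).
- exact: kahler_tube hessF pd.
- rewrite /complex_str !mulmx_block.
  by rewrite !(mul0mx, mulmx0, addr0, add0r, mul1mx, mulmx1, mulNmx, mulmxN, oppr0).
move=> p Up; rewrite (ricci_christoffel_trace oU dB dphi hessF pd tauE Up).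
set x := lsubmx p.
have -> : \matrix_(a, b) 'D_(p *m block_mx D 0 0 D) (fun q => tube_metric F q a b) p
  = block_mx (\matrix_(i, j) eval (deriv (x *m D) (partials phi [:: i; j])) x) 0 0
      (\matrix_(i, j) eval (deriv (x *m D) (partials phi [:: i; j])) x).
  have pD : lsubmx (p *m block_mx D 0 0 D) = x *m D.
    by rewrite -{1}(hsubmxK p) mul_row_block !mulmx0 addr0 row_mxKl.
  apply/matrixP => a b; rewrite mxE.
  have dg i j := derive_tube_metric F p (p *m block_mx D 0 0 D) i j.
  have dh i j : 'D_(p *m block_mx D 0 0 D) (fun q => hess F (lsubmx q) i j) p
      = eval (deriv (x *m D) (partials phi [:: i; j])) x.
    rewrite (derive_lsubmx (fun y => hess F y i j)) pD.
    by rewrite (derive_hess oU dphi hessF).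
  case: (split_ordP a) => i ->; case: (split_ordP b) => j ->.
  - by rewrite block_mxEul mxE -dh; exact: (dg i j).1.1.1.
  - by rewrite block_mxEur mxE; exact: (dg i j).1.1.2.
  - by rewrite block_mxEdl mxE; exact: (dg i j).1.2.
  - by rewrite block_mxEdr mxE -dh; exact: (dg i j).2.
rewrite /tube_metric -/x tr_block_mx !trmx0 !mulmx_block !scale_block_mx.
rewrite !(mul0mx, mulmx0, addr0, add0r, scaler0) !add_block_mx.
by rewrite !(addr0, add0r) sol.
Qed.

End TubeSolitons.

(** * Metric completeness *)

Section Completeness.
Variables (R : realType) (m : nat).
Implicit Types (c : R -> 'rV[R]_m) (p q v : 'rV[R]_m).
Local Notation mu := (@lebesgue_measure R).

Lemma eq_continuous_for (T : topologicalType) (f h : T -> R) x :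
  f =1 h -> {for x, continuous h} -> {for x, continuous f}.
Proof. by move=> /funext ->. Qed.

Lemma continuous_bigsum (T : topologicalType) (I : Type) (r : seq I)
    (f : I -> T -> R) x :
  (forall i, {for x, continuous (f i)}) ->
  {for x, continuous (fun y => \sum_(i <- r) f i y)}.
Proof.
move=> cf; elim: r => [|i r IH].
  apply: (@eq_continuous_for _ _ (cst 0)); first by move=> y; rewrite big_nil.
  exact: cst_continuous.
apply: (@eq_continuous_for _ _ (fun y => f i y + \sum_(j <- r) f j y)).
  by move=> y; rewrite big_cons.
exact: (continuousD (cf i) IH).
Qed.

Definition qform (A : 'M[R]_m) v : R := (v *m A *m v^T) 0 0.

Lemma qformE A v : qform A v = \sum_i \sum_j v 0 j * A j i * v 0 i.
Proof.
rewrite /qform mxE; apply: eq_bigr => i _.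
by rewrite !mxE mulr_suml.
Qed.

Variables (M : set 'rV[R]_m) (g : 'rV[R]_m -> 'M[R]_m).
Hypothesis oM : open M.
Hypothesis cg : forall p i j, M p -> {for p, continuous (fun q => g q i j)}.

Definition speed c t : R := Num.sqrt (qform (g (c t)) (derive1 c t)).

Lemma C1_arc_continuous c t : C1_arc M c -> {for t, continuous c}.
Proof.
by move=> [dc _ _]; have /derivable1_diffP/differentiable_continuous := dc t.
Qed.

Lemma C1_arc_velocity c i t : C1_arc M c ->
  {for t, continuous (fun s => derive1 c s 0 i)}.
Proof.
move=> [_ dc _].
apply: (@continuous_comp _ _ _ (derive1 c) (fun v : 'rV[R]_m => v 0 i)).
  exact: dc.
exact: coord_continuous.
Qed.

(** The arc lies in [M] only for times in [[0, 1]], but [M] is open: at these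
    times the speed is continuous from both sides. *)
Lemma continuous_speed c t : C1_arc M c -> 0 <= t <= 1 ->
  {for t, continuous (speed c)}.
Proof.
move=> cc t01; have [_ _ cM] := cc.
apply: (@continuous_comp _ _ _ _ Num.sqrt); last exact: sqrt_continuous.
apply: (eq_continuous_for (fun s => qformE _ _)).
apply: continuous_bigsum => i; apply: continuous_bigsum => j.
apply: continuousM; last exact: C1_arc_velocity.
apply: continuousM; first exact: C1_arc_velocity.
apply: (@continuous_comp _ _ _ c (fun p => g p j i)).
  exact: C1_arc_continuous.
by apply: cg; exact: cM.
Qed.

Lemma integrable_unit (f : R -> R) :
  (forall t, 0 <= t <= 1 -> {for t, continuous f}) ->
  mu.-integrable `[0, 1] (EFin \o f).
Proof.
move=> cf; apply: continuous_compact_integrable; first exact: segment_compact.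
apply: continuous_in_subspaceT => t.
by rewrite inE /= in_itv /=; exact: cf.
Qed.

(** [f] is [K]-Lipschitz for the Riemannian distance when the norm of its
    differential is at most [K]. *)
Section Lipschitz.
Variables (f : elem R m) (K : R).
Hypothesis df : forall p, M p -> dom f p.
Hypothesis fK : forall p v, M p ->
  eval (deriv v f) p <= K * Num.sqrt (qform (g p) v).

Lemma is_derive_along c (t : R) : C1_arc M c -> 0 <= t <= 1 ->
  is_derive t 1 (eval f \o c) (eval (deriv (derive1 c t) f) (c t)).
Proof.
move=> [dc _ cM] t01; have Mct := cM _ t01.
have dct : differentiable c t by exact/derivable1_diffP.
have dfc : differentiable (eval f) (c t) by exact/differentiable_eval/df.
have dfoc : differentiable (eval f \o c) t by exact: differentiable_comp.
apply: DeriveDef; first exact: diff_derivable.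
rewrite deriveE // diff_comp //= -deriveE // -deriveE //.
by rewrite -derive1E derive_eval //; exact: df.
Qed.

Lemma arc_Lipschitz c : C1_arc M c ->
  eval f (c 1) <= eval f (c 0) + K * arc_length g c.
Proof.
move=> cc; have [_ _ cM] := cc.
pose h t := eval (deriv (derive1 c t) f) (c t).
have ch t : 0 <= t <= 1 -> {for t, continuous h}.
  move=> t01; apply: (eq_continuous_for (fun s => deriv_sum _ _ _)).
  apply: continuous_bigsum => i; apply: continuousM; first exact: C1_arc_velocity.
  apply: (@continuous_comp _ _ _ c (eval (deriv 'e_i f))).
    exact: C1_arc_continuous.
  exact/continuous_eval/dom_deriv/df/cM.
have cfc t : 0 <= t <= 1 -> {for t, continuous (eval f \o c)}.
  move=> t01; apply: (@continuous_comp _ _ _ c (eval f)).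
    exact: C1_arc_continuous.
  exact/continuous_eval/df/cM.
have oc t : t \in `]0, 1[ -> 0 <= t <= 1.
  by rewrite in_itv /= => /andP[/ltW -> /ltW ->].
have FTC : \int[mu]_(t in `[0, 1]) h t = eval f (c 1) - eval f (c 0).
  rewrite /Rintegral (@continuous_FTC2 _ h (eval f \o c) 0 1) //.
  - apply: continuous_in_subspaceT => t.
    by rewrite inE /= in_itv /=; exact: ch.
  - split.
    + by move=> t /oc t01; case: (is_derive_along cc t01).
    + by apply: cvg_at_right_filter; apply: cfc; rewrite lexx ler01.
    + by apply: cvg_at_left_filter; apply: cfc; rewrite lexx ler01.
  - move=> t /oc t01; rewrite derive1E.
    by case: (is_derive_along cc t01).
rewrite -lerBlDl -FTC /arc_length.
rewrite -RintegralZl //; last first.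
  by apply: integrable_unit => t; exact: continuous_speed.
apply: le_Rintegral => //.
- exact: integrable_unit.
- apply: integrable_unit => t t01; apply: continuousM; first exact: cst_continuous.
  exact: continuous_speed.
- move=> t; rewrite /= in_itv /= => t01.
  by apply: fK; exact: cM.
Qed.

Lemma pw_curve_Lipschitz cs p q : pw_curve M p cs q ->
  eval f q <= eval f p + K * \sum_(c <- cs) arc_length g c.
Proof.
elim: cs p => [|c cs IH] p /=; first by move=> <-; rewrite big_nil mulr0 addr0.
move=> [cc <- /IH]; rewrite big_cons mulrDr addrA.
by move=> /le_trans; apply; rewrite lerD2r arc_Lipschitz.
Qed.

End Lipschitz.

Lemma riem_dist_ltP p q x : (riem_dist M g p q < x%:E)%E ->
  exists2 cs, pw_curve M p cs q & \sum_(c <- cs) arc_length g c < x.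
Proof. by move=> /ereal_inf_lt[_ [cs pq <-]]; rewrite lte_fin; exists cs. Qed.

Lemma pw_curve_cat p cs1 q cs2 r : pw_curve M p cs1 q -> pw_curve M q cs2 r ->
  pw_curve M p (cs1 ++ cs2) r.
Proof.
elim: cs1 p => [|c cs1 IH] p /=; first by move=> ->.
by move=> [cc c0 c1] qr; split => //; exact: IH.
Qed.

Lemma riem_dist_triangle p q r x y :
  (riem_dist M g p q < x%:E)%E -> (riem_dist M g q r < y%:E)%E ->
  (riem_dist M g p r < (x + y)%:E)%E.
Proof.
move=> /riem_dist_ltP[cs1 pq l1] /riem_dist_ltP[cs2 qr l2].
apply: (@le_lt_trans _ _ (\sum_(c <- cs1 ++ cs2) arc_length g c)%:E).
  apply: ereal_inf_lbound; exists (cs1 ++ cs2) => //.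
  exact: pw_curve_cat qr.
by rewrite lte_fin big_cat ltrD.
Qed.

Lemma qform_le (A : 'M[R]_m) v (B : R) : (forall i j, `|A i j| <= B) ->
  qform A v <= m%:R ^+ 2 * B * `|v| ^+ 2.
Proof.
move=> AB; rewrite qformE.
have vn i : `|v 0 i| <= `|v|.
  rewrite [leRHS]/Num.Def.normr /= mx_normrE.
  exact: (le_bigmax _ (fun i => `|v i.1 i.2|) (0, i)).
apply: (@le_trans _ _ (\sum_(i < m) \sum_(j < m) B * `|v| ^+ 2)).
  apply: ler_sum => i _; apply: ler_sum => j _.
  apply: le_trans (ler_norm _) _; rewrite !normrM expr2 mulrA.
  apply: ler_pM; rewrite ?mulr_ge0 ?vn //.
  by rewrite mulrC; apply: ler_pM; rewrite ?AB ?vn.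
rewrite !sumr_const !card_ord -mulrnA -[leLHS]mulr_natl natrM mulrA.
by rewrite (expr2 (m%:R : R)).
Qed.

Lemma segment_arc z p (t : R) :
  is_derive t 1 (fun s : R => z + s *: (p - z)) (p - z).
Proof.
rewrite -[X in is_derive _ _ _ X]add0r; apply: is_deriveD.
have ds : is_diff t (fun s : R => s *: (p - z)) (fun s : R => s *: (p - z)).
  exact: is_diff_scalel.
apply: DeriveDef; first exact: diff_derivable.
by rewrite deriveE // diff_val scale1r.
Qed.

(** Near [p] the metric is bounded by a multiple of the Euclidean one, so short
    segments to [p] have short length. *)
Lemma near_riem_dist p e : M p -> 0 < e ->
  \forall z \near p, (riem_dist M g z p < e%:E)%E.
Proof.
move=> Mp e0; pose B := 1 + \sum_i \sum_j `|g p i j|.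
have gB i j : `|g p i j| < B.
  rewrite ltr_pwDl // (bigD1 i) //= (bigD1 j) //= -addrA lerDl.
  by rewrite addr_ge0 // sumr_ge0 // => k _; rewrite sumr_ge0.
have B0 : 0 <= B by rewrite addr_ge0 // sumr_ge0 // => k _; rewrite sumr_ge0.
have : \forall z \near p, M z /\ forall i j, `|g z i j| <= B.
  apply: filterI; first exact: open_nbhs_nbhs.
  apply: (@filter_forall _ _ _ (nbhs p)) => i.
  apply: (@filter_forall _ _ _ (nbhs p)) => j.
  have /(_ (nbhs_filter p)) gz := cvgr_norm_lt _ (@cg p i j Mp) _ (gB i j).
  by apply: filterS gz => z /ltW.
move=> /nbhs_ballP[r /= r0 rB].
pose K := 1 + m%:R ^+ 2 * B.
have K1 : 1 <= K by rewrite lerDl mulr_ge0 // sqr_ge0.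
have K0 : 0 < K by rewrite (lt_le_trans _ K1).
have near_norm d : 0 < d -> \forall x \near p, `|p - x| < d.
  by move=> d0; have := nbhsx_ballx p d d0; rewrite -ball_normE.
near=> z.
have zr : `|p - z| < r by near: z; exact: near_norm.
have ze : K * `|p - z| < e.
  rewrite mulrC -ltr_pdivlMr //; near: z; apply: near_norm.
  by rewrite divr_gt0.
pose v : 'rV[R]_m := p - z; pose c (t : R) : 'rV[R]_m := z + t *: v.
have dc (t : R) : is_derive t 1 c v := segment_arc z p t.
have c'E (t : R) : derive1 c t = v by rewrite derive1E; case: (dc t).
have cr (t : R) : 0 <= t <= 1 -> ball p r (c t).
  move=> /andP[t0 t1]; rewrite -ball_normE /= /c opprD addrA -/v.
  rewrite -[X in X - _]scale1r -scalerBl normrZ ger0_norm ?subr_ge0 //.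
  by apply: le_lt_trans zr; rewrite ler_piMl // lerBlDr lerDl.
have cc : C1_arc M c.
  split.
  - by move=> t; case: (dc t).
  - by rewrite (funext c'E : derive1 c = cst v); exact: cst_continuous.
  - by move=> t /cr/rB[].
apply: (@le_lt_trans _ _ (arc_length g c)%:E).
  apply: ereal_inf_lbound; exists [:: c]; last by rewrite /= big_seq1.
  by split => //=; rewrite /c ?scale0r ?addr0 // scale1r /v addrC subrK.
rewrite lte_fin; apply: le_lt_trans ze.
have -> : K * `|v| = \int[mu]_(t in `[0, 1]) (K * `|v|).
  rewrite Rintegral_cst // -[LHS]mulr1; congr (_ * _).
  have := lebesgue_measure_itv `[0%R, 1%R : R].
  by rewrite /= lte_fin ltr01 oppr0 adde0 => ->.
apply: le_Rintegral => //.
- by apply: integrable_unit => t; exact: continuous_speed.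
- by apply: integrable_unit => t _; exact: cst_continuous.
move=> t; rewrite /= in_itv /= => /cr/rB[_ gcB].
rewrite c'E -/(qform _ _).
rewrite -[leRHS]ger0_norm ?mulr_ge0 // ?(ltW K0) // -sqrtr_sqr.
rewrite ler_sqrt ?sqr_ge0 //.
apply: le_trans (qform_le _ gcB) _.
rewrite exprMn ler_wpM2r ?sqr_ge0 //.
apply: (@le_trans _ _ K); first by rewrite lerDr.
by rewrite ler_eXnr.
Unshelve. all: by end_near.
Qed.

(** Gordon's criterion: [f] is Lipschitz, hence bounded on a Cauchy sequence,
    which therefore stays in a compact subset of [M] and has a cluster point
    there; a Cauchy sequence converges to its cluster points. *)
Lemma complete_of_proper (f : elem R m) (K : R) : 0 <= K ->
  (forall p, M p -> dom f p) ->
  (forall p v, M p -> eval (deriv v f) p <= K * Num.sqrt (qform (g p) v)) ->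
  (forall a, exists2 C, compact C /\ C `<=` M &
     forall p, M p -> eval f p <= a -> C p) ->
  complete_metric M g.
Proof.
move=> K0 df fK prop u Mu cauchy.
have [N uN] := cauchy 1 ltr01.
have [C [cC CM] fC] := prop (eval f (u N) + K).
have uC k : (N <= k)%N -> C (u k).
  move=> Nk; apply: fC => //.
  have /riem_dist_ltP[cs pc l1] := uN N k (leqnn N) Nk.
  apply: le_trans (pw_curve_Lipschitz df fK pc) _.
  by rewrite lerD2l ler_piMr // ltW.
have [p [Cp clp]] : C `&` cluster (u @ \oo) !=set0.
  by apply: cC; exists N => // k /= Nk; exact: uC.
exists p; first exact: CM.
move=> e e0; have e20 : 0 < e / 2 by rewrite divr_gt0.
have [N' uN'] := cauchy _ e20.
exists N' => k N'k.
have uF : (u @ \oo) (u @` [set l | (N' <= l)%N]).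
  by exists N' => // l /= N'l; exists l.
have [_ [[l /= N'l <-] zp]] := clp _ _ uF (near_riem_dist (CM _ Cp) e20).
rewrite [e]splitr; apply: riem_dist_triangle zp.
exact: uN'.
Qed.

End Completeness.

(** * The potentials of the normal family and of its dual *)

Section Potentials.
Variable R : realType.

(** The second natural parameter of the normal distribution of variance
    [sigma^2] is [- 1 / (2 sigma^2)]. *)
Definition half_precision : elem R 2 := Mul (Cst (-1)) (Coord 1).

Definition variance : elem R 2 :=
  Add (Coord 1) (Mul (Cst (-1)) (Mul (Coord 0) (Coord 0))).

Definition normal_quad : elem R 2 :=
  Mul (Cst (- 4^-1)) (Mul (Mul (Coord 0) (Coord 0)) (Inv (Coord 1))).

Definition normal_log : elem R 2 := Mul (Cst (-1)) (Ln half_precision).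

Definition dual_log : elem R 2 := Mul (Cst (-1)) (Ln variance).

End Potentials.
Arguments half_precision {R}.
Arguments variance {R}.
Arguments normal_quad {R}.
Arguments normal_log {R}.
Arguments dual_log {R}.

(** Both flows run through these two families: [c] starts at [1 / 2] and
    increases linearly in time. *)
Notation normal_pot := (pencil normal_quad normal_log).
Notation dual_pot := (pencil (Cst 0) dual_log).

Section TwoByTwo.
Variable R : realType.

Lemma sum2 (V : nmodType) (f : 'I_2 -> V) : \sum_i f i = f 0 + f 1.
Proof.
by rewrite !big_ord_recl big_ord0 addr0; congr (f _ + f _); apply: val_inj.
Qed.

Lemma ord2P (P : 'I_2 -> Prop) : P 0 -> P 1 -> forall i, P i.
Proof.
by move=> P0 P1 [[|[|//]] lt]; [move: P0 | move: P1]; congr P; apply: val_inj.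
Qed.

Definition det2 (A : 'M[R]_2) := A 0 0 * A 1 1 - A 0 1 * A 1 0.

Lemma invmx2 (A : 'M[R]_2) : det2 A != 0 ->
  ((invmx A 0 0 = A 1 1 / det2 A) * (invmx A 0 1 = - (A 0 1 / det2 A)) *
   (invmx A 1 0 = - (A 1 0 / det2 A)) * (invmx A 1 1 = A 0 0 / det2 A))%type.
Proof.
move=> d0; pose M : 'M[R]_2 := \matrix_(i, j) (
  if i == j then A (1 - i) (1 - i) / det2 A else - (A i j / det2 A)).
have MA : M *m A = 1%:M.
  by apply/matrixP; apply: ord2P; apply: ord2P; rewrite !mxE sum2 !mxE /=
    ?subr0 ?subrr; move: d0; rewrite /det2 => d0; field.
have [_ uA] := mulmx1_unit MA.
have -> : invmx A = M by rewrite -[LHS]mul1mx -MA mulmxK.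
by do !split; rewrite mxE /= ?subr0 ?subrr.
Qed.

Lemma posdef2 (A : 'M[R]_2) : A 0 1 = A 1 0 -> 0 < A 0 0 -> 0 < det2 A -> posdef A.
Proof.
move=> sA p0 pd; split.
  by apply/matrixP; apply: ord2P; apply: ord2P; rewrite mxE.
move=> v v0; rewrite mxE sum2 !mxE !sum2.
rewrite -(pmulr_rgt0 _ p0).
have -> : A 0 0 * ((v 0 0 * A 0 0 + v 0 1 * A 1 0) * v 0 0
    + (v 0 0 * A 0 1 + v 0 1 * A 1 1) * v 0 1)
   = (A 0 0 * v 0 0 + A 0 1 * v 0 1) ^+ 2 + det2 A * v 0 1 ^+ 2.
  by rewrite /det2 -sA; ring.
have [v1|v1] := eqVneq (v 0 1) 0; last first.
  by rewrite ltr_wpDl ?sqr_ge0 // mulr_gt0 // exprn_even_gt0.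
rewrite v1 mulr0 addr0 expr0n mulr0 addr0 exprn_even_gt0 //=.
apply: mulf_neq0; first by rewrite gt_eqF.
apply: contra v0 => /eqP v00; apply/eqP/rowP.
by apply: ord2P; rewrite mxE.
Qed.

Lemma delta2 : ((('e_0 : 'rV[R]_2) 0 0 = 1) * (('e_0 : 'rV[R]_2) 0 1 = 0) *
  (('e_1 : 'rV[R]_2) 0 0 = 0) * (('e_1 : 'rV[R]_2) 0 1 = 1))%type.
Proof. by do !split; rewrite mxE. Qed.

(** The inverse Hessian is the adjugate divided by the determinant. *)
Lemma christoffel_trace2 (F : 'rV[R]_2 -> R) (phi : elem R 2) i x :
  det2 (hess F x) != 0 ->
  christoffel_trace F phi i x = (2 * det2 (hess F x))^-1 *
    (hess F x 1 1 * eval (partials phi [:: 0; i; 0]) x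
     - hess F x 0 1 * eval (partials phi [:: 1; i; 0]) x
     - hess F x 1 0 * eval (partials phi [:: 0; i; 1]) x
     + hess F x 0 0 * eval (partials phi [:: 1; i; 1]) x).
Proof.
move=> d0; rewrite /christoffel_trace /base_christoffel !sum2 !invmx2 //.
by rewrite invfM; ring.
Qed.

Local Notation H phi x i j := (eval (partials phi [:: i; j]) x).

Section NormalPotential.
Variables (c : R) (x : 'rV[R]_2).
Hypotheses (c0 : 0 < c) (x1 : Omega R x).
Local Notation phi := (normal_pot c).
Let a := x 0 0.
Let b := x 0 1.

Lemma Omega_neq0 : x 0 1 != 0. Proof. by rewrite lt_eqF. Qed.

Lemma dom_normal : dom phi x.
Proof. by rewrite /= Omega_neq0 mulN1r oppr_gt0. Qed.

Lemma hess_normal :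
  ((H phi x 0 0 = - (2 * b)^-1) * (H phi x 0 1 = a / (2 * b ^+ 2)) *
   (H phi x 1 0 = a / (2 * b ^+ 2)) *
   (H phi x 1 1 = (- (a ^+ 2 / (2 * b ^+ 3)) + c / b ^+ 2)%R))%type.
Proof.
by do !split; rewrite /= !delta2 /a /b; field; rewrite ?oppr_eq0 Omega_neq0.
Qed.

Variable F : 'rV[R]_2 -> R.
Hypothesis hF : forall i j, hess F x i j = H phi x i j.

Lemma det_hess_normal : det2 (hess F x) = - (c / (2 * b ^+ 3)).
Proof. by rewrite /det2 !hF !hess_normal /a /b; field; rewrite Omega_neq0. Qed.

Lemma det_hess_normal_gt0 : 0 < det2 (hess F x).
Proof.
rewrite det_hess_normal oppr_gt0 pmulr_rlt0 // invr_lt0 pmulr_rlt0 //.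
by rewrite exprn_odd_lt0.
Qed.

Lemma posdef_normal : posdef (hess F x).
Proof.
apply: posdef2; last exact: det_hess_normal_gt0.
  by rewrite !hF !hess_normal.
by rewrite hF hess_normal oppr_gt0 invr_lt0 pmulr_rlt0.
Qed.

Lemma christoffel_trace_normal i :
  christoffel_trace F phi i x = 3 / 2 * eval (deriv 'e_i normal_log) x.
Proof.
have := det_hess_normal_gt0; rewrite lt0r => /andP[d0 _].
rewrite christoffel_trace2 // det_hess_normal !hF !hess_normal.
by move: i; apply: ord2P; rewrite /= !delta2 /a /b; field;
  rewrite ?oppr_eq0 Omega_neq0 /= gt_eqF.
Qed.

End NormalPotential.

Section DualPotential.
Variables (c : R) (x : 'rV[R]_2).
Hypotheses (c0 : 0 < c) (x1 : Omega_star R x).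
Local Notation phi := (dual_pot c).
Let u := x 0 0.
Let s := x 0 1 - x 0 0 ^+ 2.

Lemma star_gt0 : 0 < s. Proof. by rewrite subr_gt0. Qed.

Lemma dom_dual : dom phi x.
Proof. by do !split => //=; rewrite mulN1r -expr2 star_gt0. Qed.

Lemma hess_dual :
  ((H phi x 0 0 = (c * (2 / s + 4 * u ^+ 2 / s ^+ 2))%R) *
   (H phi x 0 1 = (c * (- 2 * u / s ^+ 2))%R) *
   (H phi x 1 0 = (c * (- 2 * u / s ^+ 2))%R) *
   (H phi x 1 1 = c / s ^+ 2))%type.
Proof.
have s0 : x 0 1 - x 0 0 ^+ 2 != 0 by rewrite gt_eqF // star_gt0.
have s1 : x 0 1 + - 1 * (x 0 0 * x 0 0) != 0 by rewrite mulN1r -expr2.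
by do !split; rewrite /= !delta2 /s /u; field; rewrite ?s0 ?s1.
Qed.

Variable F : 'rV[R]_2 -> R.
Hypothesis hF : forall i j, hess F x i j = H phi x i j.

Lemma det_hess_dual : det2 (hess F x) = 2 * c ^+ 2 / s ^+ 3.
Proof.
by rewrite /det2 !hF !hess_dual; field; rewrite gt_eqF // star_gt0.
Qed.

Lemma det_hess_dual_gt0 : 0 < det2 (hess F x).
Proof.
by rewrite det_hess_dual divr_gt0 ?mulr_gt0 ?exprn_gt0 ?star_gt0.
Qed.

Lemma posdef_dual : posdef (hess F x).
Proof.
apply: posdef2; last exact: det_hess_dual_gt0.
  by rewrite !hF !hess_dual.
rewrite hF hess_dual mulr_gt0 // ltr_pwDl ?divr_gt0 ?star_gt0 //.
by apply: divr_ge0; [apply: mulr_ge0; [exact: ler0n|]|]; exact: sqr_ge0.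
Qed.

Lemma christoffel_trace_dual i :
  christoffel_trace F phi i x = 3 / 2 * eval (deriv 'e_i dual_log) x.
Proof.
have := det_hess_dual_gt0; rewrite lt0r => /andP[d0 _].
have s0 : x 0 1 - x 0 0 ^+ 2 != 0 by rewrite gt_eqF // star_gt0.
have s1 : x 0 1 + - 1 * (x 0 0 * x 0 0) != 0 by rewrite mulN1r -expr2.
rewrite christoffel_trace2 // det_hess_dual !hF !hess_dual.
move: i; apply: ord2P; rewrite /= !delta2 /u /s; field;
  by rewrite ?s0 ?s1 /= gt_eqF.
Qed.

End DualPotential.

End TwoByTwo.

(** * Exhaustion functions *)

Section GradientBounds.
Variable R : realFieldType.

Lemma pow4_ge0 (x : R) : 0 <= x ^+ 4.
Proof. by rewrite (exprM x 2 2) sqr_ge0. Qed.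

Lemma mulr2_le_sqrD (x y : R) : 2 * (x * y) <= x ^+ 2 + y ^+ 2.
Proof. by have := sqr_ge0 (x - y); lra. Qed.

(** Cauchy-Schwarz, applied below to the components of the differential of the
    exhaustion in a frame that diagonalizes the metric. *)
Lemma sqr_sum4 (k t1 t2 t3 t4 g1 g2 g3 g4 : R) :
  t1 ^+ 2 <= k * g1 -> t2 ^+ 2 <= k * g2 -> t3 ^+ 2 <= k * g3 -> t4 ^+ 2 <= k * g4 ->
  (t1 + t2 + t3 + t4) ^+ 2 <= 4 * k * (g1 + g2 + g3 + g4).
Proof.
move=> h1 h2 h3 h4.
have := mulr2_le_sqrD t1 t2; have := mulr2_le_sqrD t1 t3.
have := mulr2_le_sqrD t1 t4; have := mulr2_le_sqrD t2 t3.
have := mulr2_le_sqrD t2 t4; have := mulr2_le_sqrD t3 t4.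
by lra.
Qed.

Variables (s r q y1 y2 : R).
Hypotheses (s0 : 0 < s) (sr : s * r = 1).
Let E := s ^+ 4 + r ^+ 4 + q ^+ 4 + y1 ^+ 2 + y2 ^+ 2.

Lemma exhaust_terms :
  [/\ s ^+ 4 <= E, r ^+ 4 <= E, q ^+ 4 <= E, y1 ^+ 2 <= E & y2 ^+ 2 <= E].
Proof.
have := pow4_ge0 s; have := pow4_ge0 r; have := pow4_ge0 q.
by have := sqr_ge0 y1; have := sqr_ge0 y2; rewrite /E; split; lra.
Qed.

Lemma exhaust_ge : [/\ 2 <= E, s <= E, s ^+ 2 <= E & r ^+ 2 <= E].
Proof.
have sr2 : 2 <= s ^+ 4 + r ^+ 4.
  have := mulr2_le_sqrD (s ^+ 2) (r ^+ 2); rewrite -exprMn sr expr1n -!exprM; lra.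
have := mulr2_le_sqrD (s ^+ 2) 1; have := mulr2_le_sqrD (r ^+ 2) 1.
have := mulr2_le_sqrD s 1.
rewrite -!exprM expr1n !mulr1 => h1 h2 h3.
have := pow4_ge0 s; have := pow4_ge0 r; have := pow4_ge0 q.
have := sqr_ge0 y1; have := sqr_ge0 y2.
by rewrite /E; split; lra.
Qed.

Lemma exhaust_q2 : [/\ q ^+ 2 * r <= E, q ^+ 2 * s <= E & q ^+ 2 * s ^+ 2 <= E].
Proof.
have [E2 _ s2 r2] := exhaust_ge.
have := mulr2_le_sqrD (q ^+ 2) r; have := mulr2_le_sqrD (q ^+ 2) s.
have := mulr2_le_sqrD (q ^+ 2) (s ^+ 2).
rewrite -!exprM => h1 h2 h3.
have := pow4_ge0 s; have := pow4_ge0 r; have := pow4_ge0 q.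
have := sqr_ge0 y1; have := sqr_ge0 y2.
have := mulr2_le_sqrD (s ^+ 2) 1; have := mulr2_le_sqrD (r ^+ 2) 1.
rewrite -!exprM expr1n !mulr1 => h4 h5.
have sr2 : 2 <= s ^+ 4 + r ^+ 4.
  have := mulr2_le_sqrD (s ^+ 2) (r ^+ 2); rewrite -exprMn sr expr1n -!exprM; lra.
by rewrite /E; split; lra.
Qed.

Let E0 : 0 <= E.
Proof. by have [h _ _ _] := exhaust_ge; lra. Qed.

Let s4 := pow4_ge0 s.
Let r4 := pow4_ge0 r.
Let q4 := pow4_ge0 q.
Let r0 : 0 < r.
Proof. by rewrite -(pmulr_rgt0 _ s0) sr ltr01. Qed.

Let EE (x y : R) : 0 <= x -> 0 <= y -> x <= E -> y <= E -> x * y <= E ^+ 2.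
Proof. by move=> *; rewrite expr2 ler_pM. Qed.

Let dE : (s ^+ 4 - r ^+ 4) ^+ 2 <= E ^+ 2.
Proof.
have [h1 h2 _ _ _] := exhaust_terms; have h3 := s4; have h4 := r4.
have : 0 <= (E - (s ^+ 4 - r ^+ 4)) * (E + (s ^+ 4 - r ^+ 4)).
  by apply: mulr_ge0; lra.
by lra.
Qed.

Let E2r (x y : R) : 0 <= x -> 0 <= y -> x * s <= E -> y <= E -> x * y <= E ^+ 2 * r.
Proof.
move=> x0 y0 xs yE.
have -> : x * y = x * s * y * r by rewrite -[LHS]mulr1 -sr; ring.
by rewrite ler_wpM2r ?(ltW r0) // EE ?mulr_ge0 // ltW.
Qed.

Variable c : R.
Hypothesis c0 : 0 < c.
(* Not optimal: a bound that depends only on [c] is enough. *)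
Let k := 32 * (1 + c^-1).

Let fit_c (P T : R) : 0 <= T -> P <= 32 * T -> P <= k * (c * T).
Proof.
move=> T0 PT; have -> : k * (c * T) = 32 * T + 32 * (c * T).
  by rewrite /k; field; rewrite gt_eqF.
by have := mulr_ge0 (ltW c0) T0; lra.
Qed.

Let fit_1 (P T : R) : 0 <= T -> P <= 32 * T -> P <= k * T.
Proof.
move=> T0 PT; have c1 : 0 <= c^-1 by rewrite invr_ge0 ltW.
by rewrite /k; have := mulr_ge0 c1 T0; lra.
Qed.

Let sqE (X : R) : 0 <= E ^+ 2 * X ^+ 2. Proof. by rewrite mulr_ge0 ?sqr_ge0. Qed.

Let sqEr (X : R) : 0 <= E ^+ 2 * r * X ^+ 2.
Proof. by rewrite mulr_ge0 ?sqr_ge0 // mulr_ge0 ?sqr_ge0 // ltW. Qed.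

(** The left-hand side is the squared differential of [E] and the parenthesis
    on the right is the squared length, for the metric of the normal family,
    of the same tangent vector.  With [b] the second coordinate of the base,
    one has [s = - b], [q = x_1 / b], [X] and [Y] are [dx_2 / b] and
    [dx_1 - q dx_2], and [W] and [Z] are the same for [y]. *)
Lemma gradient_bound_normal (X Y Z W : R) :
  (4 * (s ^+ 4 - r ^+ 4) * X + (- 4 * q ^+ 3 * r) * Y + 2 * y1 * Z
    + (- 2 * s * (q * y1 + y2)) * W) ^+ 2
  <= 4 * (k * E ^+ 2) * (c * X ^+ 2 + r / 2 * Y ^+ 2 + r / 2 * Z ^+ 2 + c * W ^+ 2).
Proof.
have [hs hr hq hy1 hy2] := exhaust_terms.
have [E2 sE s2 r2] := exhaust_ge; have [qr qs qss] := exhaust_q2.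
have y10 := sqr_ge0 y1; have y20 := sqr_ge0 y2; have q20 := sqr_ge0 q.
have q2r : 0 <= q ^+ 2 * r by rewrite mulr_ge0 // ltW.
have q2s : 0 <= q ^+ 2 * s ^+ 2 by rewrite mulr_ge0 ?sqr_ge0.
apply: sqr_sum4.
- have -> : k * E ^+ 2 * (c * X ^+ 2) = k * (c * (E ^+ 2 * X ^+ 2)) by ring.
  apply: fit_c => //; have := ler_wpM2r (sqr_ge0 X) dE; have := sqE X; lra.
- have -> : k * E ^+ 2 * (r / 2 * Y ^+ 2) = k * (E ^+ 2 * r * Y ^+ 2 / 2) by field.
  apply: fit_1; first by have := sqEr Y; lra.
  have := EE q4 q2r hq qr => /(ler_wpM2r (ltW r0)) /(ler_wpM2r (sqr_ge0 Y)).
  by have := sqEr Y; lra.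
- have -> : k * E ^+ 2 * (r / 2 * Z ^+ 2) = k * (E ^+ 2 * r * Z ^+ 2 / 2) by field.
  apply: fit_1; first by have := sqEr Z; lra.
  have := @E2r 1 (y1 ^+ 2) ler01 y10; rewrite !mul1r => /(_ sE hy1).
  by move=> /(ler_wpM2r (sqr_ge0 Z)); have := sqEr Z; lra.
- have -> : k * E ^+ 2 * (c * W ^+ 2) = k * (c * (E ^+ 2 * W ^+ 2)) by ring.
  apply: fit_c => //.
  have h1 := ler_wpM2r (sqr_ge0 W) (EE q2s y10 qss hy1).
  have h2 := ler_wpM2r (sqr_ge0 W) (EE (sqr_ge0 s) y20 s2 hy2).
  have h3 := mulr2_le_sqrD (s * q * y1 * W) (s * y2 * W).
  by have := sqE W; lra.
Qed.

(** The same for the dual metric, with [s = u_2 - u_1^2], [q = u_1],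
    [X = ds / s], [Y = du_1], [Z = dy_1] and [W = (dy_2 - 2 u_1 dy_1) / s]. *)
Lemma gradient_bound_dual (X Y Z W : R) :
  (4 * (s ^+ 4 - r ^+ 4) * X + 4 * q ^+ 3 * Y + (2 * y1 + 4 * q * y2) * Z
    + 2 * y2 * s * W) ^+ 2
  <= 4 * (k * E ^+ 2) *
     (c * X ^+ 2 + c * (2 * r * Y ^+ 2) + c * (2 * r * Z ^+ 2) + c * W ^+ 2).
Proof.
have [hs hr hq hy1 hy2] := exhaust_terms.
have [E2 sE s2 r2] := exhaust_ge; have [qr qs qss] := exhaust_q2.
have y10 := sqr_ge0 y1; have y20 := sqr_ge0 y2; have q20 := sqr_ge0 q.
apply: sqr_sum4.
- have -> : k * E ^+ 2 * (c * X ^+ 2) = k * (c * (E ^+ 2 * X ^+ 2)) by ring.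
  apply: fit_c => //; have := ler_wpM2r (sqr_ge0 X) dE; have := sqE X; lra.
- have -> : k * E ^+ 2 * (c * (2 * r * Y ^+ 2))
      = k * (c * (2 * (E ^+ 2 * r * Y ^+ 2))) by ring.
  apply: fit_c; first by have := sqEr Y; lra.
  have := E2r q20 q4 qs hq => /(ler_wpM2r (sqr_ge0 Y)).
  by have := sqEr Y; lra.
- have -> : k * E ^+ 2 * (c * (2 * r * Z ^+ 2))
      = k * (c * (2 * (E ^+ 2 * r * Z ^+ 2))) by ring.
  apply: fit_c; first by have := sqEr Z; lra.
  have := @E2r 1 (y1 ^+ 2) ler01 y10; rewrite !mul1r => /(_ sE hy1).
  move=> /(ler_wpM2r (sqr_ge0 Z)) h1.
  have h2 := ler_wpM2r (sqr_ge0 Z) (E2r q20 y20 qs hy2).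
  have h3 := mulr2_le_sqrD (y1 * Z) (2 * q * y2 * Z).
  by have := sqEr Z; lra.
- have -> : k * E ^+ 2 * (c * W ^+ 2) = k * (c * (E ^+ 2 * W ^+ 2)) by ring.
  apply: fit_c => //.
  have h2 := ler_wpM2r (sqr_ge0 W) (EE y20 (sqr_ge0 s) hy2 s2).
  by have := sqE W; lra.
Qed.

End GradientBounds.

Section Exhaustion.
Variable R : realType.

Lemma compact_norm_ge m (e : elem R m) (B d : R) : (forall p, dom e p) ->
  compact [set p : 'rV[R]_m | `|p| <= B /\ d <= eval e p].
Proof.
move=> de; apply: bounded_closed_compact.
  exists B; split; first exact: num_real.
  by move=> b Bb p [pB _]; apply: le_trans pB _; exact: ltW.
apply: closedI.
  apply: (@closed_comp _ _ (fun p : 'rV[R]_m => `|p|) [set x | x <= B]).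
    by move=> p _; exact: norm_continuous.
  exact: closed_le.
apply: (@closed_comp _ _ (eval e) [set x | d <= x]); last exact: closed_ge.
by move=> p _; exact: continuous_eval.
Qed.

Lemma row_norm_le m (p : 'rV[R]_m) (B : R) : 0 <= B ->
  (forall i, `|p 0 i| <= B) -> `|p| <= B.
Proof.
move=> B0 pB; rewrite [leLHS]/Num.Def.normr /= mx_normrE.
by apply: bigmax_le => // -[i j] _ /=; rewrite ord1.
Qed.

Lemma pow4_le (x B : R) : 0 <= B -> x ^+ 4 <= B -> `|x| <= 1 + B.
Proof.
move=> B0 x4; rewrite leNgt; apply/negP => h.
have x1 : 1 <= `|x| by apply: ltW; apply: le_lt_trans h; rewrite lerDl.
have : `|x| <= `|x| ^+ 4 by rewrite ler_eXnr.
by rewrite -normrX (ger0_norm (pow4_ge0 x)); lra.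
Qed.

Lemma pow2_le (x B : R) : 0 <= B -> x ^+ 2 <= B -> `|x| <= 1 + B.
Proof.
move=> B0 x4; rewrite leNgt; apply/negP => h.
have x1 : 1 <= `|x| by apply: ltW; apply: le_lt_trans h; rewrite lerDl.
have : `|x| <= `|x| ^+ 2 by rewrite ler_eXnr.
by rewrite -normrX (ger0_norm (sqr_ge0 x)); lra.
Qed.

Local Notation y1 := (Coord (rshift 2 0)).
Local Notation y2 := (Coord (rshift 2 1)).
Definition pow4 m (e : elem R m) := Mul (Mul e e) (Mul e e).
(** In both cases [s] is the argument of the logarithm of the potential, which
    vanishes on the boundary, and [q] is a coordinate that completes it.  The
    exponents make the differential of the sum bounded by the sum itself. *)
Definition exhaust_sum (s q : elem R 2) : elem R (2 + 2) :=
  let s' := rename (lshift 2) s in let q' := rename (lshift 2) q in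
  Add (Add (Add (Add (pow4 s') (pow4 (Inv s'))) (pow4 q')) (Mul y1 y1)) (Mul y2 y2).
Definition exhaust (s q : elem R 2) : elem R (2 + 2) := Ln (exhaust_sum s q).

Definition exhaust_val (s q : elem R 2) (p : 'rV[R]_(2 + 2)) : R :=
  eval s (lsubmx p) ^+ 4 + (eval s (lsubmx p))^-1 ^+ 4 + eval q (lsubmx p) ^+ 4
   + p 0 (rshift 2 0) ^+ 2 + p 0 (rshift 2 1) ^+ 2.

Lemma exhaust_sumE s q p : eval (exhaust_sum s q) p = exhaust_val s q p.
Proof.
rewrite /= !eval_rename lsubmx_row /exhaust_val.
by rewrite !(exprM _ 2 2) !expr2.
Qed.

Lemma exhaust_val_gt0 s q p : 0 < eval s (lsubmx p) -> 0 < exhaust_val s q p.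
Proof.
move=> s0; have sr : eval s (lsubmx p) * (eval s (lsubmx p))^-1 = 1.
  by rewrite mulfV // gt_eqF.
have [h _ _ _] := exhaust_ge (eval q (lsubmx p))
  (p 0 (rshift 2 0)) (p 0 (rshift 2 1)) sr.
by apply: lt_le_trans h.
Qed.

Lemma eval_deriv_rename m k (f : 'I_m -> 'I_k) (e : elem R m) v p :
  eval (deriv v (rename f e)) p
  = eval (deriv (\row_i v 0 (f i)) e) (\row_i p 0 (f i)).
Proof.
elim: e => //= [i|e1 -> e2 ->|e1 -> e2 ->|e1 ->|e1 ->] //;
  by rewrite ?mxE ?eval_rename.
Qed.

Lemma deriv_exhaust s q p v : 0 < eval s (lsubmx p) ->
  eval (deriv v (exhaust s q)) p =
  (4 * (eval s (lsubmx p) ^+ 4 - (eval s (lsubmx p))^-1 ^+ 4)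
     * (eval (deriv (lsubmx v) s) (lsubmx p) / eval s (lsubmx p))
   + 4 * eval q (lsubmx p) ^+ 3 * eval (deriv (lsubmx v) q) (lsubmx p)
   + 2 * p 0 (rshift 2 0) * v 0 (rshift 2 0)
   + 2 * p 0 (rshift 2 1) * v 0 (rshift 2 1)) / exhaust_val s q p.
Proof.
move=> s0; have s1 : eval s (lsubmx p) != 0 by rewrite gt_eqF.
rewrite -exhaust_sumE [LHS]/= -/(eval _ p); congr (_ / _).
rewrite !eval_deriv_rename !eval_rename !lsubmx_row.
by field.
Qed.

Variables (U : set 'rV[R]_2) (s q : elem R 2).
Hypothesis sU : forall x, U x <-> 0 < eval s x.
Hypothesis ds : forall x, dom s x.
Hypothesis dq : forall x, U x -> dom q x.
Hypothesis coord_bound : forall B, 1 <= B -> exists B', forall x,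
  U x -> eval s x <= B -> `|eval q x| <= B -> forall i, `|x 0 i| <= B'.

Lemma dom_exhaust p : tube U p -> dom (exhaust s q) p.
Proof.
move=> Up; have s0 : 0 < eval s (lsubmx p) by apply/sU.
split; last by rewrite exhaust_sumE exhaust_val_gt0.
by rewrite /= !dom_rename !eval_rename lsubmx_row gt_eqF //; do !split => //;
  exact: dq.
Qed.

Lemma exhaust_proper a : exists2 C, compact C /\ C `<=` tube U &
  forall p, tube U p -> eval (exhaust s q) p <= a -> C p.
Proof.
pose E := expR a; have E0 : 0 <= E by exact: expR_ge0.
have [|B' HB] := coord_bound (B := 1 + E); first by rewrite lerDl.
pose B := Num.max B' (1 + E).
have B1 : 1 + E <= B by rewrite le_max lexx orbT.
have BB : B' <= B by rewrite le_max lexx.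
exists [set p | `|p| <= B /\ (1 + E)^-1 <= eval (rename (lshift 2) s) p].
  split; first by apply: compact_norm_ge => p; rewrite dom_rename.
  move=> p [_]; rewrite eval_rename lsubmx_row => h; apply/sU.
  by apply: lt_le_trans h; rewrite invr_gt0 ltr_pwDl.
move=> p Up; have s0 : 0 < eval s (lsubmx p) by apply/sU.
have sr : eval s (lsubmx p) * (eval s (lsubmx p))^-1 = 1 by rewrite mulfV // gt_eqF.
move=> pa; have {}pa : ln (exhaust_val s q p) <= a by rewrite -exhaust_sumE.
have FE : exhaust_val s q p <= E.
  by rewrite -ler_ln ?posrE ?expR_gt0 ?exhaust_val_gt0 // expRK.
have [h1 h2 h3 h4 h5] := exhaust_terms (eval s (lsubmx p)) (eval s (lsubmx p))^-1
  (eval q (lsubmx p)) (p 0 (rshift 2 0)) (p 0 (rshift 2 1)).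
have sB := pow4_le E0 (le_trans h1 FE).
have rB := pow4_le E0 (le_trans h2 FE).
have qB := pow4_le E0 (le_trans h3 FE).
have y1B := pow2_le E0 (le_trans h4 FE).
have y2B := pow2_le E0 (le_trans h5 FE).
rewrite gtr0_norm // in sB; rewrite gtr0_norm ?invr_gt0 // in rB.
split; last first.
  rewrite eval_rename lsubmx_row -[leRHS]invrK lef_pV2 ?posrE ?invr_gt0 //.
  by rewrite ltr_pwDl.
apply: row_norm_le => [|i]; first by rewrite (le_trans _ B1) // addr_ge0.
case: (split_ordP i) => j ->.
  by have := HB _ Up sB qB j; rewrite mxE => /le_trans; apply.
by apply: le_trans B1; move: j; apply: ord2P.
Qed.

End Exhaustion.

(** * Completeness of the two families *)

Section CompleteTubes.
Variable R : realType.

Lemma Omega_half_precision (x : 'rV[R]_2) : Omega R x <-> 0 < eval half_precision x.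
Proof. by rewrite /= mulN1r oppr_gt0. Qed.

Lemma Omega_star_variance (x : 'rV[R]_2) : Omega_star R x <-> 0 < eval variance x.
Proof. by rewrite /= mulN1r subr_gt0 -expr2. Qed.

Lemma open_eval_gt0 n (e : elem R n) : (forall x, dom e x) ->
  open [set x | 0 < eval e x].
Proof.
move=> de; apply: (@open_comp _ _ (eval e) [set t | 0 < t]); last exact: open_gt.
by move=> x _; exact: continuous_eval.
Qed.

Lemma open_Omega : open (Omega R).
Proof.
rewrite (_ : Omega R = [set x | 0 < eval half_precision x]).
  exact: open_eval_gt0.
by apply/seteqP; split => x /Omega_half_precision.
Qed.

Lemma open_Omega_star : open (Omega_star R).
Proof.
rewrite (_ : Omega_star R = [set x | 0 < eval variance x]).
  exact: open_eval_gt0.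
by apply/seteqP; split => x /Omega_star_variance.
Qed.

Lemma qform_tube n (F : 'rV[R]_n -> R) p v :
  qform (tube_metric F p) v
  = qform (hess F (lsubmx p)) (lsubmx v) + qform (hess F (lsubmx p)) (rsubmx v).
Proof.
rewrite /qform -{1 2}(hsubmxK v) /tube_metric mul_row_block !mulmx0 addr0 add0r.
by rewrite tr_row_mx mul_row_col mxE.
Qed.

Lemma qform2 (A : 'M[R]_2) v : qform A v =
  A 0 0 * v 0 0 ^+ 2 + (A 0 1 + A 1 0) * v 0 0 * v 0 1 + A 1 1 * v 0 1 ^+ 2.
Proof. by rewrite qformE !sum2; ring. Qed.

Lemma ratio_bound (N E k G : R) : 0 < E -> 0 <= k ->
  N ^+ 2 <= 4 * (k * E ^+ 2) * G -> N / E <= Num.sqrt (4 * k) * Num.sqrt G.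
Proof.
move=> E0 k0 h; rewrite ler_pdivrMr //.
apply: le_trans (ler_norm _) _; rewrite -sqrtr_sqr.
rewrite -[X in _ * _ * X](ger0_norm (ltW E0)) -[X in _ * X]sqrtr_sqr.
have k4 : 0 <= 4 * k by rewrite mulr_ge0.
rewrite -sqrtrM // mulrC -sqrtrM ?sqr_ge0 //.
apply: ler_wsqrtr; apply: le_trans h _.
by rewrite le_eqVlt; apply/orP; left; apply/eqP; ring.
Qed.

(** Gordon's criterion for the logarithm of the exhaustion.  Bounding the
    numerator [N] of its differential keeps quotients out of the estimates. *)
Lemma complete_tube (U : set 'rV[R]_2) (F : 'rV[R]_2 -> R)
    (phi s q : elem R 2) (k : R) :
  open U -> (forall x, U x -> dom phi x) -> has_hess U phi F ->
  (forall x, U x <-> 0 < eval s x) -> (forall x, dom s x) ->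
  (forall x, U x -> dom q x) ->
  (forall B, 1 <= B -> exists B', forall x,
    U x -> eval s x <= B -> `|eval q x| <= B -> forall i, `|x 0 i| <= B') ->
  0 <= k ->
  (forall p v, tube U p -> exists N,
     eval (deriv v (exhaust s q)) p = N / exhaust_val s q p /\
     N ^+ 2 <= 4 * (k * exhaust_val s q p ^+ 2) * qform (tube_metric F p) v) ->
  complete_metric (tube U) (tube_metric F).
Proof.
move=> oU dphi hessF sU ds dq cb k0 grad_bound.
apply: (@complete_of_proper _ _ _ _ _ _ (exhaust s q) (Num.sqrt (4 * k))).
- exact: open_tube.
- move=> p I J Up.
  by have [+ _] := smooth_tube_metric oU dphi hessF I J 0; apply.
- exact: sqrtr_ge0.
- by move=> p; apply: dom_exhaust.
- move=> p v Up; have [N [-> NN]] := grad_bound p v Up.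
  by apply: ratio_bound => //; apply: exhaust_val_gt0; apply/sU.
- exact: exhaust_proper.
Qed.

(** The ratio [x_1 / x_2] is minus twice the mean. *)
Definition neg_two_mean : elem R 2 := Mul (Coord 0) (Inv (Coord 1)).

Lemma complete_normal c : 0 < c ->
  complete_metric (tube (Omega R)) (tube_metric (eval (normal_pot c))).
Proof.
move=> c0; have dphi x := @dom_normal R c x.
apply: (@complete_tube _ _ (normal_pot c) half_precision neg_two_mean
  (32 * (1 + c^-1))).
- exact: open_Omega.
- by move=> x Ox; exact: dphi.
- exact: (has_hess_eval open_Omega (fun x => @dom_normal R c x)).
- exact: Omega_half_precision.
- by [].
- by move=> x Ox /=; rewrite lt_eqF.
- move=> B B1; exists (B ^+ 2) => x Ox; rewrite /= mulN1r => sB qB.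
  have x1B : `|x 0 1| <= B by rewrite ltr0_norm.
  apply: ord2P; last first.
    by apply: le_trans x1B _; rewrite ler_eXnr.
  have -> : x 0 0 = x 0 0 / x 0 1 * x 0 1 by rewrite divfK // lt_eqF.
  by rewrite normrM expr2 ler_pM.
- by rewrite mulr_ge0 // addr_ge0 // invr_ge0 ltW.
move=> p v Op; set x := lsubmx p.
have b0 : x 0 1 < 0 by [].
pose s := - x 0 1; pose r := s^-1; pose q := x 0 0 / x 0 1.
have s0 : 0 < s by rewrite oppr_gt0.
have sr : s * r = 1 by rewrite mulfV // gt_eqF.
pose v1 := v 0 (lshift 2 0); pose v2 := v 0 (lshift 2 1).
pose w1 := v 0 (rshift 2 0); pose w2 := v 0 (rshift 2 1).
have vE : ((lsubmx v 0 0 = v1) * (lsubmx v 0 1 = v2) * (rsubmx v 0 0 = w1) *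
  (rsubmx v 0 1 = w2))%type by do !split; rewrite mxE.
pose X := v2 / x 0 1; pose Y := v1 - q * v2; pose Z := w1 - q * w2.
pose W := w2 / x 0 1; pose y1 := p 0 (rshift 2 0); pose y2 := p 0 (rshift 2 1).
have b0' : x 0 1 != 0 by rewrite lt_eqF.
have sE : eval half_precision x = s by rewrite /= mulN1r.
have EE : exhaust_val half_precision neg_two_mean p
    = s ^+ 4 + r ^+ 4 + q ^+ 4 + y1 ^+ 2 + y2 ^+ 2 by rewrite /exhaust_val sE.
have := gradient_bound_normal q y1 y2 s0 sr c0 X Y Z W.
rewrite -EE; set N := (X in X ^+ 2 <= _) => NN; exists N; split.
  rewrite deriv_exhaust -/x ?sE //; congr (_ / _).
  rewrite /N /X /Y /Z /W /y1 /y2 /w1 /w2 /r /s /q /= !vE.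
  by field.
apply: le_trans NN _; rewrite qform_tube !qform2 -/x.
have hE i j := has_hess_eval open_Omega (fun x => @dom_normal R c x) i j Op.
rewrite !hE !hess_normal // !vE.
rewrite le_eqVlt; apply/orP; left; apply/eqP; congr (_ * _).
rewrite /X /Y /Z /W /r /s /q; by field.
Qed.

Lemma complete_dual c : 0 < c ->
  complete_metric (tube (Omega_star R)) (tube_metric (eval (dual_pot c))).
Proof.
move=> c0; have dphi x := @dom_dual R c x.
apply: (@complete_tube _ _ (dual_pot c) variance (Coord 0) (32 * (1 + c^-1))).
- exact: open_Omega_star.
- by move=> x Ox; exact: dphi.
- exact: (has_hess_eval open_Omega_star (fun x => @dom_dual R c x)).
- exact: Omega_star_variance.
- by [].
- by [].
- move=> B B1; exists (B + B ^+ 2) => x Ox; rewrite /= mulN1r -expr2 => sB uB.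
  have B0 : 0 <= B by lra.
  have u2 : `|x 0 0| ^+ 2 <= B ^+ 2 by rewrite ler_pXn2r.
  apply: ord2P; first by apply: le_trans uB _; rewrite lerDl sqr_ge0.
  have x1 : 0 < x 0 1 by apply: le_lt_trans Ox; exact: sqr_ge0.
  rewrite gtr0_norm //; move: u2; rewrite -normrX (ger0_norm (sqr_ge0 _)); lra.
- by rewrite mulr_ge0 // addr_ge0 // invr_ge0 ltW.
move=> p v Op; set x := lsubmx p.
have s0 : 0 < x 0 1 - x 0 0 ^+ 2 by rewrite subr_gt0.
set s := x 0 1 - x 0 0 ^+ 2 in s0; pose r := s^-1; pose q := x 0 0.
have s1 : s != 0 by rewrite gt_eqF.
have sr : s * r = 1 by rewrite mulfV.
pose v1 := v 0 (lshift 2 0); pose v2 := v 0 (lshift 2 1).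
pose w1 := v 0 (rshift 2 0); pose w2 := v 0 (rshift 2 1).
have vE : ((lsubmx v 0 0 = v1) * (lsubmx v 0 1 = v2) * (rsubmx v 0 0 = w1) *
  (rsubmx v 0 1 = w2))%type by do !split; rewrite mxE.
pose X := (v2 - 2 * q * v1) / s.
pose W := (w2 - 2 * q * w1) / s.
pose y1 := p 0 (rshift 2 0); pose y2 := p 0 (rshift 2 1).
have sE : eval variance x = s by rewrite /= mulN1r -expr2.
have EE : exhaust_val variance (Coord 0) p
    = s ^+ 4 + r ^+ 4 + q ^+ 4 + y1 ^+ 2 + y2 ^+ 2 by rewrite /exhaust_val sE.
have := gradient_bound_dual q y1 y2 s0 sr c0 X v1 w1 W.
rewrite -EE; set N := (X in X ^+ 2 <= _) => NN; exists N; split.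
  rewrite deriv_exhaust -/x ?sE //; congr (_ / _).
  rewrite /N /X /W /y1 /y2 /w1 /w2 /r /q /= !vE.
  by field.
apply: le_trans NN _; rewrite qform_tube !qform2 -/x.
have hE i j := has_hess_eval open_Omega_star (fun x => @dom_dual R c x) i j Op.
rewrite !hE !hess_dual // !vE -/s.
rewrite le_eqVlt; apply/orP; left; apply/eqP; congr (_ * _).
rewrite /X /W /r /q; by field.
Qed.

End CompleteTubes.

(** * Legendre duality and the theorem *)

Section Legendre.
Variable R : realType.
Local Notation Om := (Omega R).
Local Notation Os := (Omega_star R).
Local Notation M0 := normal_quad.
Local Notation M1 := normal_log.
Local Notation W1 := dual_log.

Lemma eval_normal c (x : 'rV[R]_2) : eval (pencil M0 M1 c) x =
  - (x 0 0 ^+ 2 / (4 * x 0 1)) - c * ln (- x 0 1).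
Proof. by rewrite /= !mulN1r invfM; ring. Qed.

Lemma eval_dual c (u : 'rV[R]_2) : eval (pencil (Cst 0) W1 c) u =
  - (c * ln (u 0 1 - u 0 0 ^+ 2)).
Proof. by rewrite /= !mulN1r add0r mulrN expr2. Qed.

Lemma log_partitionE (x : 'rV[R]_2) : Om x ->
  log_partition R x = eval (pencil M0 M1 2^-1) x + 2^-1 * ln pi.
Proof.
move=> x1; rewrite eval_normal /log_partition.
have -> : - (x 0 1 / pi) = - x 0 1 / pi by rewrite mulNr.
rewrite ln_div ?posrE ?pi_gt0 ?oppr_gt0 //; ring.
Qed.

Lemma has_hess_log_partition : has_hess Om (pencil M0 M1 2^-1) (log_partition R).
Proof.
exact (@has_hess_addc R 2 Om _ (@open_Omega R) (fun x => @dom_normal R _ x)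
  (log_partition R) (2^-1 * ln pi) log_partitionE).
Qed.

Lemma soliton_normal : kr_soliton (tube Om) (tube_metric (log_partition R)).
Proof.
have c0 : 0 < 2^-1 :> R by rewrite invr_gt0.
have hF := has_hess_log_partition.
have dB x : Om x -> dom M1 x by move=> /(@dom_normal R 1 x)[_ []].
(* The field [(3/2) z_1 d/dz_1]. *)
pose D : 'M[R]_2 := \matrix_(i, j) (if (i == 0) && (j == 0) then 3 / 2 else 0).
apply: (@soliton_tube _ _ _ _ (pencil M0 M1 2^-1) M1 (3 / 2) (- 3) D) => //.
- exact: open_Omega.
- exact: dom_normal.
- by move=> x Ox; exact (posdef_normal c0 Ox (fun i j => hF x i j Ox)).
- by move=> i x Ox; exact (christoffel_trace_normal c0 Ox (fun i j => hF x i j Ox) i).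
move=> x Ox; have b0 : x 0 1 != 0 by rewrite lt_eqF.
set w := x *m D.
have w0 : w 0 0 = 3 / 2 * x 0 0 by rewrite !mxE sum2 !mxE /=; ring.
have w1 : w 0 1 = 0 by rewrite !mxE sum2 !mxE /=; ring.
have hB i j := has_hess_eval (@open_Omega R) dB i j Ox.
have hFx i j := hF x i j Ox.
move: (hess (eval M1) x) (hess (log_partition R) x) hB hFx => HB HF hB hFx.
by apply/matrixP; apply: ord2P; apply: ord2P;
  rewrite !mxE !sum2 !mxE hB !hFx !hess_normal //= !delta2 w0 w1; field;
  rewrite ?oppr_eq0 b0.
Qed.

(** A star-shaped set is a union of segments with a common end. *)
Lemma connected_star m (A : set 'rV[R]_m) x0 : A x0 ->
  (forall x (t : R), A x -> 0 <= t <= 1 -> A (x0 + t *: (x - x0))) -> connected A.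
Proof.
move=> Ax0 star.
have -> : A = \bigcup_(x in A) [set x0 + t *: (x - x0) | t in `[0 : R, 1]].
  apply/seteqP; split => [x Ax|y [x Ax [t]]].
    exists x => //; exists 1; first by rewrite /= in_itv /= ler01 lexx.
    by rewrite scale1r addrC subrK.
  by rewrite /= in_itv /= => t01 <-; exact: star.
apply: bigcup_connected.
  exists x0 => x Ax; exists 0; first by rewrite /= in_itv /= ler01 lexx.
  by rewrite scale0r addr0.
move=> x Ax; apply: connected_continuous_connected; first exact: segment_connected.
apply: continuous_subspaceT => t.
have [dt _] := segment_arc x0 x t.
by have /derivable1_diffP/differentiable_continuous := dt.
Qed.

Definition vec2 (a b : R) : 'rV[R]_2 := \row_i (if i == 0 then a else b).

Lemma vec2E a b : ((vec2 a b 0 0 = a) * (vec2 a b 0 1 = b))%type.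
Proof. by split; rewrite mxE. Qed.

Lemma connected_Omega : connected Om.
Proof.
apply: (@connected_star _ _ (vec2 0 (-1))).
  by rewrite /Omega /= vec2E oppr_lt0.
move=> x t x1 /andP[t0 t1]; rewrite /Omega /= !mxE /= in x1 *.
by have := x1; rewrite /Omega /= => h; nra.
Qed.

Lemma connected_Omega_star : connected Os.
Proof.
apply: (@connected_star _ _ (vec2 0 1)).
  by rewrite /Omega_star /= !vec2E expr0n.
move=> x t x1 /andP[t0 t1]; rewrite /Omega_star /= !mxE /= in x1 *.
have h : x 0 0 ^+ 2 < x 0 1 by [].
have tt : t * t <= t by rewrite ler_piMl.
have h2 := ler_wpM2r (sqr_ge0 (x 0 0)) tt.
have [t1'|t1'] := eqVneq t 1; first by rewrite t1'; lra.
have : t < 1 by rewrite lt_neqAle t1' t1.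
have := ler_wpM2l t0 (ltW h).
by lra.
Qed.

Lemma grad_eval m (U : set 'rV[R]_m) (e : elem R m) (F : 'rV[R]_m -> R) x :
  open U -> (forall y, U y -> dom e y) -> (forall y, U y -> F y = eval e y) -> U x ->
  grad F x = \row_i eval (deriv 'e_i e) x.
Proof.
move=> oU de Fe Ux; apply/rowP => i; rewrite !mxE -derive_eval; last exact: de.
exact: (eq_open_derive _ oU Fe Ux).
Qed.

Section Dual.
Variable c : R.
Hypothesis c0 : 0 < c.
Local Notation FM := (eval (pencil M0 M1 c)).
Local Notation FW := (eval (pencil (Cst 0) W1 c)).

Lemma grad_normal x : Om x -> grad FM x =
  vec2 (- (x 0 0 / (2 * x 0 1))) (x 0 0 ^+ 2 / (4 * x 0 1 ^+ 2) - c / x 0 1).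
Proof.
move=> Ox; have b0 : x 0 1 != 0 by rewrite lt_eqF.
rewrite (grad_eval (@open_Omega R) (fun y => @dom_normal R c y)
  (fun _ _ => erefl) Ox).
by apply/rowP; apply: ord2P; rewrite vec2E mxE /= !delta2; field;
  rewrite ?oppr_eq0 b0.
Qed.

(** The inverse of the gradient map, where the supremum defining the Legendre
    transform is reached. *)
Definition dual_point (u : 'rV[R]_2) : 'rV[R]_2 :=
  vec2 (2 * c * u 0 0 / (u 0 1 - u 0 0 ^+ 2)) (- (c / (u 0 1 - u 0 0 ^+ 2))).

Lemma dual_point_Omega u : Os u -> Om (dual_point u).
Proof.
by move=> Ou; rewrite /Omega /= vec2E oppr_lt0 divr_gt0 // subr_gt0.
Qed.

Lemma grad_normal_image : grad FM @` Om = Os.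
Proof.
apply/seteqP; split => [_ [x Ox <-]|u Ou].
  have b0 : x 0 1 != 0 by rewrite lt_eqF.
  rewrite grad_normal // /Omega_star /= !vec2E -subr_gt0.
  have -> : x 0 0 ^+ 2 / (4 * x 0 1 ^+ 2) - c / x 0 1
      - (- (x 0 0 / (2 * x 0 1))) ^+ 2
    = c / - x 0 1 by field; rewrite ?oppr_eq0 b0.
  by rewrite divr_gt0 // oppr_gt0.
have s0 : u 0 1 - u 0 0 ^+ 2 != 0 by rewrite gt_eqF // subr_gt0.
exists (dual_point u); first exact: dual_point_Omega.
rewrite grad_normal; last exact: dual_point_Omega.
apply/rowP; apply: ord2P; rewrite !vec2E; field; by rewrite ?s0 gt_eqF.
Qed.

(** The upper bound combines the square of [x_1 / 2 + x_2 u_1] with the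
    inequality [ln z <= z - 1] at [z = - x_2 s / c]; both are equalities at
    [dual_point u]. *)
Lemma legendre_normal (F : 'rV[R]_2 -> R) k u :
  (forall x, Om x -> F x = FM x + k) -> Os u ->
  has_sup (legendre_set Om F u) /\
  legendre Om F u = FW u + (c * ln c - c - k).
Proof.
move=> Fk Ou; set v := FW u + _.
have s0 : 0 < u 0 1 - u 0 0 ^+ 2 by rewrite subr_gt0.
have s1 : u 0 1 - u 0 0 ^+ 2 != 0 by rewrite gt_eqF.
have dotE (x : 'rV[R]_2) : (x *m u^T) 0 0 = x 0 0 * u 0 0 + x 0 1 * u 0 1.
  by rewrite mxE sum2 !mxE.
have ubv : ubound (legendre_set Om F u) v.
  move=> _ [x Ox <-]; rewrite Fk // eval_normal /v eval_dual dotE.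
  have b0 : x 0 1 < 0 by [].
  have sq : x 0 0 * u 0 0 + x 0 0 ^+ 2 / (4 * x 0 1) + x 0 1 * u 0 0 ^+ 2 <= 0.
    have -> : x 0 0 * u 0 0 + x 0 0 ^+ 2 / (4 * x 0 1) + x 0 1 * u 0 0 ^+ 2
      = (x 0 0 / 2 + x 0 1 * u 0 0) ^+ 2 / x 0 1 by field; rewrite lt_eqF.
    by rewrite mulr_ge0_le0 ?sqr_ge0 // invr_le0 ltW.
  set s := u 0 1 - u 0 0 ^+ 2 in s0 s1 *.
  have z0 : 0 < - x 0 1 * s / c by rewrite divr_gt0 ?mulr_gt0 ?oppr_gt0.
  have := @le_ln1Dx R (- x 0 1 * s / c - 1).
  rewrite ltrBDr addNr z0 addrC subrK => /(_ isT).
  rewrite ln_div ?posrE ?mulr_gt0 ?oppr_gt0 // lnM ?posrE ?oppr_gt0 //.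
  move=> /(ler_wpM2l (ltW c0)).
  have -> : c * (- x 0 1 * s / c - 1) = - x 0 1 * s - c by field; rewrite gt_eqF.
  move: sq; rewrite /s; lra.
have Av : legendre_set Om F u v.
  exists (dual_point u); first exact: dual_point_Omega.
  rewrite Fk ?eval_normal ?dotE; last exact: dual_point_Omega.
  rewrite /v eval_dual !vec2E opprK ln_div ?posrE //.
  by field; rewrite ?s1 gt_eqF.
have nA : legendre_set Om F u !=set0 by exists v.
have bA : has_ubound (legendre_set Om F u) by exists v.
split; first by split.
by apply/eqP; rewrite eq_le ge_sup // ub_le_sup.
Qed.

Lemma potential_normal : kahler_potential Om FM.
Proof.
split.
- exact: open_Omega.
- exact: connected_Omega.
- by exists (vec2 0 (-1)); rewrite /Omega /= vec2E oppr_lt0.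
- by apply: smooth_eval => [|x]; [exact: open_Omega|exact: dom_normal].
- move=> x Ox.
  exact (posdef_normal c0 Ox (fun i j =>
    has_hess_eval (@open_Omega R) (fun y => @dom_normal R c y) i j Ox)).
Qed.

Lemma has_hess_dual k : has_hess Os (pencil (Cst 0) W1 c) (fun u => FW u + k).
Proof.
exact (@has_hess_addc R 2 Os _ (@open_Omega_star R) (fun x => @dom_dual R c x) _ k
  (fun _ _ => erefl)).
Qed.

Lemma potential_dual k : kahler_potential Os (fun u => FW u + k).
Proof.
split.
- exact: open_Omega_star.
- exact: connected_Omega_star.
- by exists (vec2 0 1); rewrite /Omega_star /= !vec2E expr0n ltr01.
- apply: (@smooth_eval _ _ _ (Add (pencil (Cst 0) W1 c) (Cst k))).
    exact: open_Omega_star.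
  by move=> x Ox; split => //; exact: dom_dual.
- by move=> x Ox; exact (posdef_dual c0 Ox (fun i j => @has_hess_dual k x i j Ox)).
Qed.

Lemma mirror_normal :
  mirror_pair Om FM Os (fun u => FW u + (c * ln c - c)).
Proof.
split; [exact: potential_normal|exact: potential_dual|exact: grad_normal_image|].
move=> u Ou; have [|hs lE] := @legendre_normal FM 0 u _ Ou.
  by move=> x _; rewrite addr0.
by split => //; rewrite lE subr0.
Qed.

End Dual.

Lemma has_hess_legendre :
  has_hess Os (pencil (Cst 0) W1 2^-1) (legendre Om (log_partition R)).
Proof.
have c0 : 0 < 2^-1 :> R by rewrite invr_gt0.
apply: (@has_hess_addc R 2 Os _ (@open_Omega_star R) (fun x => @dom_dual R 2^-1 x) _
  (2^-1 * ln 2^-1 - 2^-1 - 2^-1 * ln pi)) => u Ou.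
by have [_ ->] := legendre_normal c0 log_partitionE Ou.
Qed.

Lemma soliton_dual :
  kr_soliton (tube Os) (tube_metric (legendre Om (log_partition R))).
Proof.
have c0 : 0 < 2^-1 :> R by rewrite invr_gt0.
have hF := has_hess_legendre.
have dB x : Os x -> dom W1 x by move=> /(@dom_dual R 1 x)[_ []].
apply: (@soliton_tube _ _ _ _ (pencil (Cst 0) W1 2^-1) W1 (3 / 2) (- 3) 0) => //.
- exact: open_Omega_star.
- exact: dom_dual.
- by move=> x Ox; exact (posdef_dual c0 Ox (fun i j => hF x i j Ox)).
- by move=> i x Ox; exact (christoffel_trace_dual c0 Ox (fun i j => hF x i j Ox) i).
move=> x Ox; have hB i j := has_hess_eval (@open_Omega_star R) dB i j Ox.
have hFx i j := hF x i j Ox.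
move: (hess (eval W1) x) (hess (legendre _ _) x) hB hFx => HB HF hB hFx.
rewrite trmx0 mulmx0 mul0mx !addr0 mulmx0.
apply/matrixP => i j; rewrite !mxE deriv0 addr0 hB hFx partials_pencil.
by rewrite [eval (partials (Cst 0) _) _]/= add0r; field.
Qed.

End Legendre.

Theorem proposition3 (R : realType) :
  let Phi : 'rV[R]_2 -> R := log_partition R in
  let Phi_star : 'rV[R]_2 -> R := legendre (Omega R) Phi in
  [/\ kr_soliton (tube (Omega R)) (tube_metric Phi),
      kr_soliton (tube (Omega_star R)) (tube_metric Phi_star)
    & exists Phit Psit : R -> 'rV[R]_2 -> R,
      [/\ krf_solution (tube (Omega R)) (fun t => tube_metric (Phit t)),
          krf_solution (tube (Omega_star R)) (fun t => tube_metric (Psit t)),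
          (forall t, 0 <= t ->
             complete_metric (tube (Omega R)) (tube_metric (Phit t)) /\
             complete_metric (tube (Omega_star R)) (tube_metric (Psit t))),
          ((forall p, tube (Omega R) p ->
              tube_metric (Phit 0) p = tube_metric Phi p) /\
           (forall p, tube (Omega_star R) p ->
              tube_metric (Psit 0) p = tube_metric Phi_star p))
        & forall t, 0 <= t ->
            mirror_pair (Omega R) (Phit t) (Omega_star R) (Psit t)]].
Proof.
move=> Phi Phi_star; split; [exact: soliton_normal | exact: soliton_dual |].
pose c (t : R) := 2^-1 + 2 * (3 / 2) * t.
have h0 : 0 < 2^-1 :> R by rewrite invr_gt0.
have k0 : 0 <= 3 / 2 :> R by rewrite divr_ge0.
have ct t : 0 <= t -> 0 < c t.
  by move=> t0; rewrite ltr_wpDr // mulr_ge0 // mulr_ge0.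
pose FM t := eval (normal_pot (c t)).
pose FW t := eval (dual_pot (c t)).
exists FM, (fun t u => FW t u + (c t * ln (c t) - c t)).
have dM c' x : Omega R x -> dom (normal_pot c') x by exact: dom_normal.
have dW c' x : Omega_star R x -> dom (dual_pot c') x by exact: dom_dual.
have WE t : tube_metric (fun u => FW t u + (c t * ln (c t) - c t))
    = tube_metric (FW t).
  exact: tube_metric_addc.
split.
- apply: krf_pencil => //.
  + exact: open_Omega.
  + by move=> x /(dM 1)[].
  + by move=> x /(dM 1)[_ []].
  + move=> c' x c'0 Ox.
    exact (posdef_normal c'0 Ox (fun i j =>
      has_hess_eval (@open_Omega R) (dM c') i j Ox)).
  + move=> c' i x c'0 Ox.
    exact (christoffel_trace_normal c'0 Ox (fun i j =>
      has_hess_eval (@open_Omega R) (dM c') i j Ox) i).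
- rewrite (funext WE); apply: krf_pencil => //.
  + exact: open_Omega_star.
  + by move=> x /(dW 1)[_ []].
  + move=> c' x c'0 Ox.
    exact (posdef_dual c'0 Ox (fun i j =>
      has_hess_eval (@open_Omega_star R) (dW c') i j Ox)).
  + move=> c' i x c'0 Ox.
    exact (christoffel_trace_dual c'0 Ox (fun i j =>
      has_hess_eval (@open_Omega_star R) (dW c') i j Ox) i).
- move=> t t0; rewrite WE; split; [exact/complete_normal/ct | exact/complete_dual/ct].
- have c0E : c 0 = 2^-1 by rewrite /c mulr0 addr0.
  split=> p Up.
    rewrite /FM c0E; apply: eq_tube_metric Up.
      exact (has_hess_eval (@open_Omega R) (dM 2^-1)).
    exact: has_hess_log_partition.
  rewrite WE /FW c0E; apply: eq_tube_metric Up.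
    exact (has_hess_eval (@open_Omega_star R) (dW 2^-1)).
  exact: has_hess_legendre.
- by move=> t t0; exact/mirror_normal/ct.
Qed.
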